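(* Let $K'/K$ be a finite separable field extension and let $v$ be a pseudo-absolute value on $K$ with finiteness ring $A_v$ and residue field $\kappa_v$. Let $A'$ be the integral closure of $A_v$ in $K'$. For each maximal ideal $\mathfrak m_w\in\operatorname{Spm}(A')$, let $\kappa_w$ be the residue field of the localisation $A'_{\mathfrak m_w}$, a finite extension of $\kappa_v$. Then there is a bijective correspondence between the set of pseudo-absolute values on $K'$ above $v$ and the set of extensions of the residue absolute value of $v$ with respect to the extensions $\kappa_v\to\kappa_w$, where $\mathfrak m_w$ runs over the set of maximal ideals of $A'$ (that is, pairs consisting of a maximal ideal $\mathfrak m_w$ and an absolute value on $\kappa_w$ extending the residue absolute value of $v$). Furthermore, we have the equality $$\sum_{\mathfrak m_w\in\operatorname{Spm}(A')}\frac{1}{|\operatorname{Spm}(A')|}\sum_{i\mid v}\frac{[\widehat{\kappa_{w,i}}:\widehat{\kappa_v}]_s}{[\kappa_w:\kappa_v]_s}=1,$$ where, for each $\mathfrak m_w\in\operatorname{Spm}(A')$, $i$ runs over the set of extensions of the residue absolute value of $v$ to $\kappa_w$ and $\widehat{\kappa_{w,i}}$ denotes the completion of $\kappa_w$ for the absolute value $i$.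
   Context: A pseudo-absolute value on a field $K$ is a map $|\cdot| : K\to[0,+\infty]$ such that (i) $|1|=1$, $|0|=0$; (ii) $|a+b|\le |a|+|b|$; (iii) $|ab|=|a||b|$ whenever $\{|a|,|b|\}\neq\{0,+\infty\}$. Its finiteness ring $\{a:|a|<+\infty\}$ is a valuation ring of $K$ with maximal ideal $\{a:|a|=0\}$, and $|\cdot|$ induces an absolute value on its residue field (the residue absolute value). A pseudo-absolute value on $K'$ is above $v$ if its restriction to $K$ is $v$. $\operatorname{Spm}(A')$ is the set of maximal ideals of $A'$; it is finite. $\widehat{\kappa_v}$ is the completion of $\kappa_v$ for the residue absolute value, and $[\,\cdot:\cdot\,]_s$ is the separable degree of a finite extension. *)

(* Defs.v *)
From HB Require Import structures.
From mathcomp Require Import all_boot all_order all_algebra all_field.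
From mathcomp Require Import finmap.
From mathcomp Require Import boolp classical_sets functions cardinality fsbigop.
From mathcomp Require Import reals ereal.
From mathcomp Require Import ring lra.

Set Implicit Arguments.
Unset Strict Implicit.
Unset Printing Implicit Defensive.

Import Order.TTheory GRing.Theory Num.Theory.
Local Open Scope ring_scope.

Record subring (B : comNzRingType) := Subring {
  sr_pred :> B -> bool;
  sr_closed : subring_closed sr_pred
}.

Section SubringType.
Variables (B : comNzRingType) (A : subring B).

HB.instance Definition _ :=
  GRing.isSubringClosed.Build B (sr_pred A) (sr_closed A).

Record subring_type := SubringElt { sr_val : B; _ : sr_pred A sr_val }.

HB.instance Definition _ := [isSub for sr_val].
HB.instance Definition _ := [Choice of subring_type by <:].
HB.instance Definition _ := [SubChoice_isSubComNzRing of subring_type by <:].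

Lemma sr_valP (x : subring_type) : A (sr_val x).
Proof. by case: x. Qed.

Lemma sr_val_is_zmod : zmod_morphism sr_val.
Proof. exact: (raddfB (val : subring_type -> B)). Qed.

Lemma sr_val_is_monoid : monoid_morphism sr_val.
Proof.
by split; [exact: (rmorph1 (val : subring_type -> B)) |
  exact: (rmorphM (val : subring_type -> B))].
Qed.

HB.instance Definition _ :=
  GRing.isZmodMorphism.Build subring_type B sr_val sr_val_is_zmod.
HB.instance Definition _ :=
  GRing.isMonoidMorphism.Build subring_type B sr_val sr_val_is_monoid.

Lemma sr_val_inj : injective sr_val. Proof. exact: val_inj. Qed.
Lemma sr_val0 : sr_val 0 = 0. Proof. exact: rmorph0. Qed.
Lemma sr_val1 : sr_val 1 = 1. Proof. exact: rmorph1. Qed.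
Lemma sr_valD x y : sr_val (x + y) = sr_val x + sr_val y.
Proof. exact: rmorphD. Qed.
Lemma sr_valB x y : sr_val (x - y) = sr_val x - sr_val y.
Proof. exact: rmorphB. Qed.
Lemma sr_valM x y : sr_val (x * y) = sr_val x * sr_val y.
Proof. exact: rmorphM. Qed.
Definition sr_valE := (sr_val0, sr_val1, sr_valB, sr_valD, sr_valM).
End SubringType.
Coercion subring_type : subring >-> Sortclass.

(* [idealr_closed] includes [1 \notin I]: its ideals are proper. *)
Record max_ideal (A : comNzRingType) := MaxIdeal {
  mi_pred :> A -> bool;
  mi_ideal : idealr_closed mi_pred;
  mi_max : forall J : {pred A}, idealr_closed J ->
    {subset mi_pred <= J} -> {subset J <= mi_pred}
}.

HB.instance Definition _ (A : comNzRingType) := gen_eqMixin (max_ideal A).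
HB.instance Definition _ (A : comNzRingType) := gen_choiceMixin (max_ideal A).

Section MaxIdeal.
Variable A : comNzRingType.

Lemma max_of_inv (I : A -> bool) :
  (forall x, ~~ I x -> exists y, I (x * y - 1)) ->
  forall J : {pred A}, idealr_closed J -> {subset I <= J} -> {subset J <= I}.
Proof.
move=> inv J [J0 J1 JD] sIJ x Jx; apply: contraT => /inv[y Ixy].
case/negP: J1; have -> : 1 = y * x + ((-1) * (x * y - 1) + 0) by ring.
by apply: (JD _ _ _ Jx); apply: JD => //; exact: sIJ.
Qed.

Variable I : max_ideal A.

HB.instance Definition _ := isIdealr.Build A (mi_pred I) (mi_ideal I).
Definition mi_idealr : idealr A := mi_pred I.

Lemma max_inv x : ~~ I x -> exists y, I (x * y - 1).
Proof.
move=> Ix; apply: contrapT => nex; case/negP: Ix.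
have [I0 I1 ID] := mi_ideal I.
pose J : {pred A} := fun z => `[< exists y, I (x * y + z) >].
have sIJ : {subset mi_pred I <= J}.
  by move=> z Iz; apply/asboolP; exists 0; rewrite mulr0 add0r.
apply: (@mi_max _ I J) => //.
  split; first by apply: sIJ.
    apply/negP => /asboolP[y Iy]; apply: nex; exists (- y).
    have -> : x * - y - 1 = (-1) * (x * y + 1) + 0 by ring.
    exact: ID.
  move=> a u w /asboolP[y Iy] /asboolP[z Iz]; apply/asboolP.
  exists (a * y + z).
  have -> : x * (a * y + z) + (a * u + w) = a * (x * y + u) + (x * z + w) by ring.
  exact: ID.
apply/asboolP; exists (-1); rewrite mulrN1 addNr; exact: I0.
Qed.

Definition residue := {ideal_quot mi_idealr}.
HB.instance Definition _ := GRing.ComNzRing.on residue.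

Definition resid (x : A) : residue := \pi_({ideal_quot mi_idealr})%qT x.
Definition resid_repr (c : residue) : A := generic_quotient.repr c.

Lemma resid_reprK : cancel resid_repr resid.
Proof. exact: generic_quotient.reprK. Qed.

Lemma resid_is_zmod : zmod_morphism resid.
Proof. exact: (raddfB (\pi_({ideal_quot mi_idealr})%qT)). Qed.
Lemma resid_is_monoid : monoid_morphism resid.
Proof.
split; first exact: (rmorph1 (\pi_({ideal_quot mi_idealr})%qT)).
exact: (rmorphM (\pi_({ideal_quot mi_idealr})%qT)).
Qed.
HB.instance Definition _ :=
  GRing.isZmodMorphism.Build A residue resid resid_is_zmod.
HB.instance Definition _ :=
  GRing.isMonoidMorphism.Build A residue resid resid_is_monoid.

Lemma resid_eq x y : (resid x == resid y) = I (x - y).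
Proof.
by rewrite [RHS](Quotient.idealrBE mi_idealr x y).
Qed.

Lemma resid_eq0 x : (resid x == 0) = I x.
Proof. by rewrite -(rmorph0 resid) resid_eq subr0. Qed.

Lemma residue_inv_ex (c : residue) :
  exists d : residue, (c != 0 -> d * c = 1) /\ (c = 0 -> d = 0).
Proof.
have [->|c0] := eqVneq c 0; first by exists 0.
rewrite -[c]resid_reprK in c0 *; rewrite resid_eq0 in c0.
have [y Iy] := max_inv c0; exists (resid y); split=> [_|e].
  by apply/eqP; rewrite -rmorphM -(rmorph1 resid) resid_eq mulrC.
by move: c0; rewrite -resid_eq0 e eqxx.
Qed.

Definition residue_inv (c : residue) : residue := projT1 (cid (residue_inv_ex c)).

Lemma residue_mulVf (c : residue) : c != 0 -> residue_inv c * c = 1.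
Proof. exact: (proj1 (projT2 (cid (residue_inv_ex c)))). Qed.

Lemma residue_invr0 : residue_inv 0 = 0.
Proof. exact: (proj2 (projT2 (cid (residue_inv_ex 0)))). Qed.

HB.instance Definition _ :=
  GRing.ComNzRing_isField.Build residue residue_mulVf residue_invr0.

Lemma max_primeN x y : ~~ I x -> ~~ I y -> ~~ I (x * y).
Proof. by rewrite -!resid_eq0 rmorphM; exact: mulf_neq0. Qed.

End MaxIdeal.

Section ResidueMap.
Variables (A B : comNzRingType) (I : max_ideal A) (J : max_ideal B).
Variables (g : {rmorphism A -> B}) (gIJ : forall x, I x -> J (g x)).

Definition residue_map of (forall x, I x -> J (g x)) :=
  fun c : residue I => resid J (g (resid_repr c)).

Lemma residue_mapE x : residue_map gIJ (resid I x) = resid J (g x).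
Proof.
apply/eqP; rewrite /residue_map resid_eq -rmorphB; apply: gIJ.
by rewrite -resid_eq resid_reprK.
Qed.

Lemma residue_map_is_zmod : zmod_morphism (residue_map gIJ).
Proof.
move=> c d; rewrite -[c]resid_reprK -[d]resid_reprK -rmorphB.
by rewrite !residue_mapE !rmorphB.
Qed.
Lemma residue_map_is_monoid : monoid_morphism (residue_map gIJ).
Proof.
split; first by rewrite -(rmorph1 (resid I)) residue_mapE !rmorph1.
move=> c d; rewrite -[c]resid_reprK -[d]resid_reprK -rmorphM.
by rewrite !residue_mapE !rmorphM.
Qed.
HB.instance Definition _ := GRing.isZmodMorphism.Build (residue I) (residue J)
  (residue_map gIJ) residue_map_is_zmod.
HB.instance Definition _ := GRing.isMonoidMorphism.Build (residue I) (residue J)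
  (residue_map gIJ) residue_map_is_monoid.
End ResidueMap.

(* The localisation of a subring of a field at a maximal ideal, as a subring of
   that field. *)
Section Localization.
Variables (F : fieldType) (A : subring F) (m : max_ideal A).

Definition loc_pred (x : F) :=
  `[< exists a s : A, ~~ m s /\ x = sr_val a / sr_val s >].

Lemma den_neq0 (s : A) : ~~ m s -> sr_val s != 0.
Proof.
apply: contraNneq => s0; have -> : s = 0 by apply: sr_val_inj; rewrite /= s0.
by case: (mi_ideal m).
Qed.

Lemma den1 : ~~ m 1.
Proof. by case: (mi_ideal m). Qed.

Lemma loc_closed : subring_closed loc_pred.
Proof.
split.
- by apply/asboolP; exists 1, 1; split; [exact: den1 | rewrite sr_val1 divr1].
- move=> x y /asboolP[a [s [ms ->]]] /asboolP[b [t [mt ->]]].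
  apply/asboolP; exists (a * t - b * s), (s * t).
  split; first exact: max_primeN.
  have := den_neq0 ms; have := den_neq0 mt.
  by rewrite !sr_valE => t0 s0; field; rewrite t0 s0.
- move=> x y /asboolP[a [s [ms ->]]] /asboolP[b [t [mt ->]]].
  apply/asboolP; exists (a * b), (s * t).
  split; first exact: max_primeN.
  by rewrite !sr_valE mulf_div.
Qed.

Definition localization : subring F := Subring loc_closed.

Definition loc_max_pred (x : localization) :=
  `[< exists a s : A, [/\ m a, ~~ m s & sr_val x = sr_val a / sr_val s] >].

Lemma loc_maxE (x : localization) (a s : A) : ~~ m s ->
  sr_val x = sr_val a / sr_val s -> loc_max_pred x = m a.
Proof.
move=> ms ex; apply/asboolP/idP; last by move=> ma; exists a, s.
case=> b [t [mb mt]]; rewrite ex => /eqP.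
rewrite eqr_div ?den_neq0// -!sr_valM => /eqP/sr_val_inj e.
apply: contraT => ma; have := max_primeN ma mt; rewrite e mulrC.
by case: (mi_ideal m) => I0 _ ID; move=> /negP[]; have := ID s b 0 mb I0; rewrite addr0.
Qed.

Lemma loc_max_ideal : idealr_closed loc_max_pred.
Proof.
have [I0 I1 ID] := mi_ideal m; split.
- by rewrite -[_ \in _]/(loc_max_pred 0) (@loc_maxE _ 0 1) ?den1 // !sr_val0 mul0r.
- by rewrite -[_ \in _]/(loc_max_pred 1) (@loc_maxE _ 1 1) ?den1 // !sr_val1 divr1.
move=> u x y /asboolP[a [s [ma ms ex]]] /asboolP[b [t [mb mt ey]]].
have /asboolP[c [r [mr eu]]] := sr_valP u.
have [s0 [t0 r0]] := (den_neq0 ms, (den_neq0 mt, den_neq0 mr)).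
rewrite -[_ \in _]/(loc_max_pred (u * x + y)) (@loc_maxE _ ((c * t) * a + (r * s) * b) ((r * s) * t)).
- by apply: (ID (c * t) a (r * s * b)) => //; have := ID (r * s) b 0 mb I0; rewrite addr0.
- by do 2! [apply: max_primeN => //].
rewrite !sr_valE ex ey eu /=.
by field; rewrite s0 t0 r0.
Qed.

Lemma loc_max_inv (x : localization) : ~~ loc_max_pred x ->
  exists y, loc_max_pred (x * y - 1).
Proof.
have /asboolP[a [s [ms ex]]] := sr_valP x.
rewrite (loc_maxE ms ex) => ma.
have ly : loc_pred (sr_val s / sr_val a) by apply/asboolP; exists s, a.
exists (SubringElt (A := localization) ly).
have -> : x * (SubringElt (A := localization) ly) = 1.
  apply: sr_val_inj; rewrite sr_valM sr_val1 /= ex mulf_div [sr_val s * _]mulrC divff//.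
  by rewrite mulf_neq0 ?den_neq0.
by rewrite subrr; case: loc_max_ideal.
Qed.

Definition loc_max : max_ideal localization :=
  MaxIdeal loc_max_ideal (max_of_inv loc_max_inv).
End Localization.

Section Absval.
Variable R : realType.

Record absval (F : fieldType) := Absval {
  av_fun :> F -> R;
  av_ge0 : forall x, 0 <= av_fun x;
  av_eq0 : forall x, av_fun x = 0 <-> x = 0;
  avD : forall x y, av_fun (x + y) <= av_fun x + av_fun y;
  avM : forall x y, av_fun (x * y) = av_fun x * av_fun y
}.

Record absval_ext (F E : fieldType) (iota : {rmorphism F -> E})
    (a : absval F) := AbsvalExt {
  ext_av :> absval E;
  ext_avE : forall x, ext_av (iota x) = a x
}.

HB.instance Definition _ F E iota a := gen_eqMixin (@absval_ext F E iota a).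
HB.instance Definition _ F E iota a := gen_choiceMixin (@absval_ext F E iota a).

Section AbsvalTheory.
Variables (F : fieldType) (a : absval F).

Lemma av0 : a 0 = 0. Proof. exact/av_eq0. Qed.
Lemma av_neq0 x : x != 0 -> a x != 0.
Proof. by apply: contra_neq => /av_eq0. Qed.
Lemma av_gt0 x : x != 0 -> 0 < a x.
Proof. by move=> x0; rewrite lt_def av_neq0 ?av_ge0. Qed.
Lemma av1 : a 1 = 1.
Proof.
by apply: (mulfI (av_neq0 (oner_neq0 F))); rewrite -avM !mulr1.
Qed.
Lemma avN x : a (- x) = a x.
Proof.
rewrite -mulN1r avM; suff -> : a (-1) = 1 by rewrite mul1r.
have : a (-1) ^+ 2 = 1 by rewrite expr2 -avM mulrNN mul1r av1.
by move/eqP; rewrite sqrf_eq1 => /orP[] /eqP // e; have := av_ge0 a (-1); rewrite e; lra.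
Qed.
Lemma avV x : a x^-1 = (a x)^-1.
Proof.
have [->|x0] := eqVneq x 0; first by rewrite invr0 av0 invr0.
by apply: (mulfI (av_neq0 x0)); rewrite -avM !divff ?av1 ?av_neq0.
Qed.
Lemma avB x y : a (x - y) <= a x + a y.
Proof. by rewrite (le_trans (avD _ _ _))// avN. Qed.
End AbsvalTheory.

(* The completion of [F] for [a]: Cauchy sequences modulo null sequences. *)
Section Completion.
Variables (F : fieldType) (a : absval F).

Definition cauchy_pred (u : nat -> F) :=
  `[< forall e : R, 0 < e -> exists N, forall m n,
        (N <= m)%N -> (N <= n)%N -> a (u m - u n) < e >].

Lemma cauchy_bound u : cauchy_pred u ->
  exists2 M : R, 0 < M & exists N, forall n, (N <= n)%N -> a (u n) <= M.
Proof.
move/asboolP/(_ 1 ltr01) => [N hN]; exists (a (u N) + 1).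
  by have := av_ge0 a (u N); lra.
exists N => n Nn; have := hN n N Nn (leqnn N).
by have := avD a (u n - u N) (u N); rewrite subrK; lra.
Qed.

Lemma cauchy_closed : subring_closed cauchy_pred.
Proof.
split.
- by apply/asboolP => e e0; exists 0%N => m n _ _; rewrite subrr av0.
- move=> u w /asboolP hu /asboolP hw; apply/asboolP => e e0.
  have [N1 h1] := hu (e / 2) ltac:(lra); have [N2 h2] := hw (e / 2) ltac:(lra).
  exists (maxn N1 N2) => m n; rewrite !geq_max => /andP[m1 m2] /andP[n1 n2].
  rewrite !fctE.
  have -> : u m - w m - (u n - w n) = (u m - u n) - (w m - w n) by ring.
  by have := h1 m n m1 n1; have := h2 m n m2 n2; have := avB a (u m - u n) (w m - w n); lra.
- move=> u w hu hw; apply/asboolP => e e0.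
  have [M M0 [N3 h3]] := cauchy_bound hu.
  have [L L0 [N4 h4]] := cauchy_bound hw.
  move: hu hw => /asboolP hu /asboolP hw.
  have eL : 0 < e / 2 / L by rewrite !divr_gt0.
  have eM : 0 < e / 2 / M by rewrite !divr_gt0.
  have [N1 h1] := hu _ eL; have [N2 h2] := hw _ eM.
  exists (maxn (maxn N1 N2) (maxn N3 N4)) => m n; rewrite !geq_max.
  move=> /andP[/andP[m1 m2] /andP[m3 m4]] /andP[/andP[n1 n2] /andP[n3 n4]].
  rewrite !fctE.
  have -> : u m * w m - u n * w n = u m * (w m - w n) + (u m - u n) * w n by ring.
  apply: (le_lt_trans (avD _ _ _)); rewrite !avM.
  have : a (u m) * a (w m - w n) <= M * a (w m - w n).
    by rewrite ler_wpM2r ?av_ge0 ?h3.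
  have : a (u m - u n) * a (w n) <= a (u m - u n) * L.
    by rewrite ler_wpM2l ?av_ge0 ?h4.
  have := h1 m n m1 n1; have := h2 m n m2 n2.
  by rewrite !ltr_pdivlMr// [_ * M]mulrC; lra.
Qed.

Definition cauchy_ring : subring (nat -> F) := Subring cauchy_closed.

Definition null_pred (u : cauchy_ring) :=
  `[< forall e : R, 0 < e -> exists N, forall n,
        (N <= n)%N -> a (sr_val u n) < e >].

Lemma null_ideal : idealr_closed null_pred.
Proof.
split.
- by apply/asboolP => e e0; exists 0%N => n _; rewrite /= av0.
- apply/negP => /asboolP/(_ 1 ltr01)[N /(_ N (leqnn N))].
  by rewrite /= av1 ltxx.
move=> c u w /asboolP hu /asboolP hw; apply/asboolP => e e0.
have [M M0 [N3 h3]] := cauchy_bound (sr_valP c).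
have eM : 0 < e / 2 / M by rewrite !divr_gt0.
have [N1 h1] := hu _ eM; have [N2 h2] := hw (e / 2) ltac:(lra).
exists (maxn (maxn N1 N2) N3) => n; rewrite !geq_max => /andP[/andP[n1 n2] n3].
rewrite !sr_valE /= !fctE.
have := avD a (sr_val c n * sr_val u n) (sr_val w n); rewrite avM.
have : a (sr_val c n) * a (sr_val u n) <= M * a (sr_val u n).
  by rewrite ler_wpM2r ?av_ge0 ?h3.
have := h1 n n1; have := h2 n n2.
by rewrite !ltr_pdivlMr// [_ * M]mulrC; lra.
Qed.

Lemma null_inv (u : cauchy_ring) : ~~ null_pred u ->
  exists w, null_pred (u * w - 1).
Proof.
move=> /asboolPn /existsNP[e /not_implyP[e0 /forallNP nN]].
have e2 : 0 < e / 2 by lra.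
have /asboolP hu := sr_valP u; have [N hN] := hu _ e2.
have /existsNP[k /not_implyP[Nk /negP]] := nN N; rewrite -leNgt => ek.
have ub n : (N <= n)%N -> e / 2 <= a (sr_val u n).
  move=> Nn; have := hN k n Nk Nn.
  by have := avD a (sr_val u k - sr_val u n) (sr_val u n); rewrite subrK; lra.
have u0 n : (N <= n)%N -> sr_val u n != 0.
  by move=> /ub; apply: contraTneq => ->; rewrite av0 -ltNge.
have cw : cauchy_pred (fun n => (sr_val u n)^-1).
  apply/asboolP => d d0.
  have ed : 0 < d * (e / 2 * (e / 2)) by rewrite !mulr_gt0.
  have [P hP] := hu _ ed; exists (maxn N P) => m n.
  rewrite !geq_max => /andP[m1 m2] /andP[n1 n2].
  have -> : (sr_val u m)^-1 - (sr_val u n)^-1 =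
      (sr_val u n - sr_val u m) / (sr_val u m * sr_val u n).
    by field; rewrite !u0.
  rewrite avM avV avM ltr_pdivrMr ?mulr_gt0 ?av_gt0 ?u0//.
  apply: (lt_le_trans (hP n m n2 m2)); rewrite ler_pM2l//.
  by rewrite ler_pM ?ub// ltW.
exists (SubringElt (A := cauchy_ring) cw); apply/asboolP => d d0; exists N => n Nn.
by rewrite !sr_valE /= !fctE divff ?u0// subrr av0.
Qed.

Definition null_max : max_ideal cauchy_ring :=
  MaxIdeal null_ideal (max_of_inv null_inv).

Definition completion : fieldType := residue null_max.
End Completion.

(* The map between completions extending [iota] by continuity. *)
Section CompletionMap.
Variables (F E : fieldType) (iota : {rmorphism F -> E}) (a : absval F).
Variable b : absval_ext iota a.

Lemma cauchy_map_subproof (u : cauchy_ring a) :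
  cauchy_pred b (iota \o sr_val u).
Proof.
apply/asboolP => e e0; have /asboolP/(_ e e0)[N hN] := sr_valP u.
by exists N => m n Nm Nn; rewrite /= -rmorphB ext_avE hN.
Qed.

Definition cauchy_map (u : cauchy_ring a) : cauchy_ring b :=
  SubringElt (A := cauchy_ring b) (cauchy_map_subproof u).

Lemma cauchy_map_is_zmod : zmod_morphism cauchy_map.
Proof.
by move=> u w; apply: sr_val_inj; apply/funext => n; rewrite /= !fctE rmorphB.
Qed.
Lemma cauchy_map_is_monoid : monoid_morphism cauchy_map.
Proof.
split; first by apply: sr_val_inj; apply/funext => n; rewrite /= rmorph1.
by move=> u w; apply: sr_val_inj; apply/funext => n; rewrite /= !fctE rmorphM.
Qed.
HB.instance Definition _ := GRing.isZmodMorphism.Build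
  (cauchy_ring a) (cauchy_ring b) cauchy_map cauchy_map_is_zmod.
HB.instance Definition _ := GRing.isMonoidMorphism.Build
  (cauchy_ring a) (cauchy_ring b) cauchy_map cauchy_map_is_monoid.

Lemma null_map u : null_max a u -> null_max b (cauchy_map u).
Proof.
move=> /asboolP hu; apply/asboolP => e /hu[N hN]; exists N => n /hN.
by rewrite /= ext_avE.
Qed.

Definition completion_map : {rmorphism completion a -> completion b} :=
  residue_map null_map.
End CompletionMap.
End Absval.

Section SeparableDegree.
Variables (F E : fieldType) (iota : {rmorphism F -> E}).

(* [p] is the minimal polynomial of [x] over [F]. *)
Definition separable_over (x : E) :=
  exists p : {poly F}, [/\ p \is monic, irreducible_poly p,
    root (map_poly iota p) x & separable_poly p].

Definition is_sepdeg (n : nat) := exists b : 'I_n -> E,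
  [/\ forall i, separable_over (b i),
      forall c : 'I_n -> F, \sum_i iota (c i) * b i = 0 -> forall i, c i = 0 &
      forall x, separable_over x -> exists c : 'I_n -> F,
        x = \sum_i iota (c i) * b i].

(* The dimension over [F] of the separable closure of [F] in [E]; it is 0 when
   this dimension is infinite. *)
Definition sepdeg : nat := xget 0%N [set n | is_sepdeg n]%classic.
End SeparableDegree.

Section PseudoAbsval.
Variable R : realType.
Local Open Scope ereal_scope.

Record pseudo_absval (K : fieldType) := PseudoAbsval {
  pav_fun :> K -> \bar R;
  pav_ge0 : forall x, 0 <= pav_fun x;
  pav1 : pav_fun 1%R = 1;
  pav0 : pav_fun 0%R = 0;
  pavD : forall x y, pav_fun (x + y)%R <= pav_fun x + pav_fun y;
  pavM : forall x y,
    [set pav_fun x; pav_fun y]%classic <> [set 0; +oo]%classic ->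
    pav_fun (x * y)%R = pav_fun x * pav_fun y
}.

Section Theory.
Variables (K : fieldType) (v : pseudo_absval K).

Lemma pavM_fin x y : v x < +oo -> v y < +oo -> v (x * y)%R = v x * v y.
Proof.
move=> xf yf; apply: pavM => e; have : [set 0; +oo]%classic (+oo : \bar R) by right.
by rewrite -e => -[] /= e'; rewrite -e' ltxx in xf yf.
Qed.

Lemma pavM_gt0 x y : 0 < v x -> 0 < v y -> v (x * y)%R = v x * v y.
Proof.
move=> xf yf; apply: pavM => e; have : [set 0; +oo]%classic (0 : \bar R) by left.
by rewrite -e => -[] /= e'; rewrite -e' ltxx in xf yf.
Qed.

Lemma pavM_unit x y : 0 < v x < +oo -> v (x * y)%R = v x * v y.
Proof.
move=> /andP[x0 xf]; apply: pavM => e; have : [set v x; v y]%classic (v x) by left.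
by rewrite e => -[] /= e'; rewrite e' ltxx in x0 xf.
Qed.

Lemma pavN1 : v (-1)%R = 1.
Proof.
have e : v (-1)%R * v (-1)%R = 1.
  rewrite -[RHS](pav1 v) -[1%R in RHS]mulr1 -mulrNN; apply/esym/pavM => e.
  have [h0 hoo] : [set v (-1)%R; v (-1)%R]%classic 0 /\
    [set v (-1)%R; v (-1)%R]%classic +oo by rewrite e; split; [left|right].
  by move: h0 hoo => [] /= <- [].
move: e (pav_ge0 v (-1)%R); case: (v (-1)%R) => [r| |] //=.
rewrite -EFinM lee_fin => -[] /eqP; rewrite -expr2 sqrf_eq1 => /orP[]/eqP -> //.
by rewrite oppr_ge0 ler10.
Qed.

Lemma pavN x : v (- x)%R = v x.
Proof.
by rewrite -mulN1r pavM_unit pavN1 ?mul1e// lte01 ltry.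
Qed.

Lemma pavB x y : v (x - y)%R <= v x + v y.
Proof. by rewrite (le_trans (pavD _ _ _))// pavN. Qed.

Lemma pav_sub0 x y : v (x - y)%R = 0 -> v x = v y.
Proof.
move=> e; apply/eqP; rewrite eq_le; apply/andP; split.
  by have := pavD v (x - y)%R y; rewrite subrK e add0e.
by have := pavB x (x - y)%R; rewrite subKr e adde0.
Qed.

Lemma fin_closed : subring_closed (fun x => v x < +oo).
Proof.
split; first by rewrite unfold_in pav1 ltry.
- move=> x y; rewrite !unfold_in => xf yf.
  by rewrite (le_lt_trans (pavB _ _))// lte_add_pinfty.
- move=> x y; rewrite !unfold_in => xf yf; rewrite pavM_fin// lte_mul_pinfty//.
    exact: pav_ge0.
  by rewrite ge0_fin_numE ?pav_ge0.
Qed.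

Definition fin_ring : subring K := Subring fin_closed.

Lemma fin_valP (x : fin_ring) : v (sr_val x) < +oo.
Proof. exact: (@sr_valP _ fin_ring x). Qed.

Lemma fin_ideal : idealr_closed (fun x : fin_ring => v (sr_val x) == 0).
Proof.
split; rewrite ?unfold_in /=; first by rewrite pav0.
  by rewrite pav1 onee_eq0.
move=> u x y; rewrite !unfold_in => /eqP x0 /eqP y0.
rewrite !sr_valE /= eq_le pav_ge0 andbT (le_trans (pavD _ _ _))//.
by rewrite y0 adde0 pavM_fin ?fin_valP// x0 mule0.
Qed.

Lemma fin_unit (x : fin_ring) : v (sr_val x) != 0 ->
  exists y : fin_ring, (x * y)%R = 1%R.
Proof.
move=> xn0.
have x0 : sr_val x != 0%R by apply: contra_neq xn0 => ->; exact: pav0.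
have xu : 0 < v (sr_val x) < +oo by rewrite lt_def xn0 pav_ge0 fin_valP.
have yf : v (sr_val x)^-1%R < +oo.
  have := pavM_unit (sr_val x)^-1%R xu; rewrite divff// pav1.
  rewrite ltNge leye_eq; apply: contra_eqN => /eqP ->.
  by case/andP: xu => xgt0 _; rewrite gt0_muley.
exists (SubringElt (A := fin_ring) yf).
by apply: sr_val_inj; rewrite sr_valM sr_val1 /= divff.
Qed.

Lemma fin_inv (x : fin_ring) : v (sr_val x) != 0 ->
  exists y : fin_ring, v (sr_val (x * y - 1)%R) == 0.
Proof.
by move=> /fin_unit[y xy]; exists y; rewrite xy subrr sr_val0 pav0.
Qed.

Definition fin_max : max_ideal fin_ring :=
  MaxIdeal fin_ideal (max_of_inv fin_inv).

Definition res_field : fieldType := residue fin_max.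

Definition res_av (c : res_field) : R := fine (v (sr_val (resid_repr c))).

Lemma res_avE (x : fin_ring) : res_av (resid fin_max x) = fine (v (sr_val x)).
Proof.
rewrite /res_av; congr fine; apply: pav_sub0; apply/eqP.
by rewrite -rmorphB -[_ == _]/(fin_max _) -resid_eq resid_reprK.
Qed.

Lemma fin_val_num (x : fin_ring) : v (sr_val x) \is a fin_num.
Proof. by rewrite ge0_fin_numE ?pav_ge0 ?fin_valP. Qed.

Lemma res_av_ge0 c : (0 <= res_av c)%R.
Proof. by rewrite fine_ge0 ?pav_ge0. Qed.

Lemma res_av_eq0 c : res_av c = 0%R <-> c = 0%R.
Proof.
rewrite -[c]resid_reprK; set x := resid_repr c.
rewrite res_avE; split => [e|/eqP].
  by apply/eqP; rewrite resid_eq0 /=; apply/eqP; rewrite -(fineK (fin_val_num x)) e.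
by rewrite resid_eq0 /= => /eqP ->.
Qed.

Lemma res_avD c d : (res_av (c + d) <= res_av c + res_av d)%R.
Proof.
rewrite -[c]resid_reprK -[d]resid_reprK -rmorphD !res_avE.
rewrite -fineD ?fin_val_num// fine_le ?fin_numD ?fin_val_num//.
by rewrite sr_valD pavD.
Qed.

Lemma res_avM c d : res_av (c * d) = (res_av c * res_av d)%R.
Proof.
rewrite -[c]resid_reprK -[d]resid_reprK -rmorphM !res_avE.
by rewrite sr_valM pavM_fin ?fin_valP// fineM ?fin_val_num.
Qed.

Definition res_absval : absval R res_field :=
  Absval res_av_ge0 res_av_eq0 res_avD res_avM.
End Theory.

Record pav_above (K : fieldType) (K' : fieldExtType K) (v : pseudo_absval K) :=
  PavAbove {
    above_pav :> pseudo_absval K';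
    above_pavE : forall x : K, above_pav x%:A%R = v x
  }.

End PseudoAbsval.

Section IntegralClosure.
Variables (R : realType) (K : fieldType) (K' : fieldExtType K).
Variable v : pseudo_absval R K.

Definition fin_inj : {rmorphism fin_ring v -> K'} :=
  (in_alg K' : {rmorphism K -> K'}) \o @sr_val K (fin_ring v).

Definition int_pred (x : K') := `[< integralOver fin_inj x >].

Lemma int_closed : subring_closed int_pred.
Proof.
split; first by apply/asboolP; exact: integral1.
- by move=> x y /asboolP ix /asboolP iy; apply/asboolP; exact: integral_sub.
- by move=> x y /asboolP ix /asboolP iy; apply/asboolP; exact: integral_mul.
Qed.

Definition int_closure : subring K' := Subring int_closed.

Definition Spm := max_ideal int_closure.
HB.instance Definition _ := Choice.on Spm.

Lemma fin_int (x : fin_ring v) : int_closure (fin_inj x).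
Proof. by apply/asboolP; exact: integral_id. Qed.

Definition fin_to_int (x : fin_ring v) : int_closure :=
  SubringElt (A := int_closure) (fin_int x).

Lemma fin_to_int_is_zmod : zmod_morphism fin_to_int.
Proof.
by move=> x y; apply: sr_val_inj; rewrite sr_valB; exact: (rmorphB fin_inj).
Qed.
Lemma fin_to_int_is_monoid : monoid_morphism fin_to_int.
Proof.
split; first by apply: sr_val_inj; rewrite sr_val1; exact: (rmorph1 fin_inj).
by move=> x y; apply: sr_val_inj; rewrite sr_valM; exact: (rmorphM fin_inj).
Qed.
HB.instance Definition _ := GRing.isZmodMorphism.Build
  (fin_ring v) int_closure fin_to_int fin_to_int_is_zmod.
HB.instance Definition _ := GRing.isMonoidMorphism.Build
  (fin_ring v) int_closure fin_to_int fin_to_int_is_monoid.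

Section ResidueFieldAt.
Variable m : Spm.

Definition kappa : fieldType := residue (loc_max m).

Lemma fin_loc (x : fin_ring v) : localization m (fin_inj x).
Proof.
apply/asboolP; exists (fin_to_int x), 1.
by split; [exact: den1 | rewrite rmorph1 divr1].
Qed.

Definition fin_to_loc (x : fin_ring v) : localization m :=
  SubringElt (A := localization m) (fin_loc x).

Lemma fin_to_loc_is_zmod : zmod_morphism fin_to_loc.
Proof.
by move=> x y; apply: sr_val_inj; rewrite sr_valB; exact: (rmorphB fin_inj).
Qed.
Lemma fin_to_loc_is_monoid : monoid_morphism fin_to_loc.
Proof.
split; first by apply: sr_val_inj; rewrite sr_val1; exact: (rmorph1 fin_inj).
by move=> x y; apply: sr_val_inj; rewrite sr_valM; exact: (rmorphM fin_inj).
Qed.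
HB.instance Definition _ := GRing.isZmodMorphism.Build
  (fin_ring v) (localization m) fin_to_loc fin_to_loc_is_zmod.
HB.instance Definition _ := GRing.isMonoidMorphism.Build
  (fin_ring v) (localization m) fin_to_loc fin_to_loc_is_monoid.

Lemma fin_max_to_int x : fin_max v x -> m (fin_to_int x).
Proof.
move=> mx; apply: contraT => /max_inv[y].
rewrite -resid_eq0 rmorphB rmorphM rmorph1 subr_eq0 => /eqP xy1.
have /asboolP[p pmon proot] := sr_valP y.
pose phi : {rmorphism fin_ring v -> residue m} := resid m \o fin_to_int.
have phiroot : (map_poly phi p).[resid m y] = 0.
  have e0 : (map_poly fin_to_int p).[y] = 0.
    apply: sr_val_inj; rewrite sr_val0 -horner_map -map_poly_comp.
    exact/rootP.
  by rewrite (map_poly_comp (resid m)) horner_map e0 rmorph0.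
set n := (size p).-1.
have szp : size p = n.+1 by rewrite /n prednK// size_poly_gt0 monic_neq0.
pose s := \sum_(i < n.+1) p`_i * x ^+ (n - i).
have phis : phi s = 0.
  have -> : phi s = phi x ^+ n * (map_poly phi p).[resid m y].
    have -> : (map_poly phi p).[resid m y] =
        \sum_(i < n.+1) phi p`_i * resid m y ^+ i.
      rewrite (@horner_coef_wide _ n.+1); last by rewrite -szp size_poly.
      by apply: eq_bigr => i _; rewrite coef_map.
    rewrite /s rmorph_sum mulr_sumr; apply: eq_bigr => i _.
    rewrite rmorphM rmorphXn mulrCA; congr (_ * _).
    have le_in : (i <= n)%N by rewrite -ltnS.
    have -> : phi x ^+ n = phi x ^+ (n - i) * phi x ^+ i by rewrite -exprD subnK.
    by rewrite -mulrA -exprMn [phi x * _]xy1 expr1n mulr1.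
  by rewrite phiroot mulr0.
have ms : ~~ fin_max v s.
  rewrite -resid_eq0.
  have /eqP rx : resid (fin_max v) x == 0 by rewrite resid_eq0.
  have -> : resid (fin_max v) s = 1.
    rewrite /s big_ord_recr /= subnn expr0 mulr1 rmorphD rmorph_sum big1 => [|i _].
      have -> : p`_n = 1 by apply/eqP; rewrite -[_ == _]/(p \is monic).
      by rewrite rmorph1 add0r.
    by rewrite rmorphM rmorphXn /= rx expr0n subn_eq0 leqNgt ltn_ord mulr0.
  exact: oner_neq0.
have [w sw] := fin_unit ms.
have := rmorphM phi s w; rewrite sw phis rmorph1 mul0r => /eqP.
by rewrite oner_eq0.
Qed.

Lemma fin_max_to_loc x : fin_max v x -> loc_max m (fin_to_loc x).
Proof.
move=> /fin_max_to_int mx; rewrite -[is_true _]/(is_true (loc_max_pred _)).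
by rewrite (@loc_maxE _ _ _ _ (fin_to_int x) 1) ?den1// sr_val1 divr1.
Qed.

Definition kappa_map : {rmorphism res_field v -> kappa} :=
  residue_map fin_max_to_loc.

Definition residue_ext := absval_ext kappa_map (res_absval v).
HB.instance Definition _ := Choice.on residue_ext.
End ResidueFieldAt.
End IntegralClosure.

(* Main.v *)
Require Import Defs.
From HB Require Import structures.
From mathcomp Require Import all_boot all_order all_algebra all_field.
From mathcomp Require Import finmap.
From mathcomp Require Import boolp classical_sets functions cardinality fsbigop.
From mathcomp Require Import reals ereal.
From mathcomp Require Import ring lra.

(** The correspondence rests on one fact: for a maximal ideal [m] of the integral
    closure [A'] of the finiteness ring [A] of [v], the localisation at [m] is a
    valuation ring of [K'] ([localization_valuation]).  Its proof scales an
    algebraic equation of an element [x] so that its coefficients lie in [A] and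
    one of them is [1]; the truncations of the equation then give integral
    elements [b] and [c] with [b x] and [c x] integral and [b = c x + 1], and one
    of [b], [c x] is invertible at [m].  A pseudo-absolute value [w] above [v] is
    finite on [A'], and its zeros in [A'] form a maximal ideal [m]
    ([contraction]).  It is finite on the localisation at [m] and induces an
    absolute value on the residue field; outside the localisation it is infinite,
    since there the inverse lies in the maximal ideal.  So [w] is determined by
    [m] and the residual absolute value, and conversely any absolute value of the
    residue field at [m] that extends the one of [v], continued by infinity
    outside the localisation, is a pseudo-absolute value ([glue_pav]).

    The maximal ideals are finite in number, because elements that lie in all
    but one of them are independent over [K] ([spm_bound]), and there is at least
    one.  Hence the average over them of a quantity that is always [1] is [1],
    and it remains to prove a statement on a finite extension [L / k] and an
    absolute value [a] of [k] ([sum_local_sepdeg]): the local separable degrees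
    add up to the separable degree of [L / k].

    Let [t] generate the separable closure of [k] in [L], let [P] be its minimal
    polynomial and let [kh] be the completion of [k].  Each extension [i] of [a]
    to [L] selects an irreducible factor of [P] over [kh], the one that vanishes
    at the image of [t] in the completion of [L] for [i].  This completion is
    finite over [kh], being spanned by [L], and purely inseparable over [kh(t)],
    so its separable degree is the degree of the factor ([local_sepdeg]).  The
    factor determines [i], since two norms on a finite-dimensional space over
    [kh] are equivalent and equivalent absolute values that agree on [kh] are
    equal ([local_factor_le]).  Every factor occurs, since [a] extends to the
    field that the factor defines over [kh] and from there to [L]
    ([local_factor_exists]).  As [P] is separable, the degrees of its distinct
    factors add up to the degree of [P].

    Absolute values extend along finite extensions by an argument that does not
    distinguish archimedean from ultrametric ones: a basis gives a
    submultiplicative norm, and a minimal submultiplicative seminorm below it is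
    multiplicative ([seminorm_dominates_absval]). *)

Set Implicit Arguments.
Unset Strict Implicit.
Unset Printing Implicit Defensive.

Import Order.TTheory GRing.Theory Num.Theory.
Local Open Scope ring_scope.

(** * Seminorms and the extension of absolute values *)

Section RealHelpers.
Variable R : realType.
Implicit Types (x y z C : R) (S T : set R).

Lemma inf_le_mem S (x : R) : (forall s, S s -> 0 <= s) -> S x -> inf S <= x.
Proof. by move=> S0 Sx; apply: ge_inf => //; exists 0 => s /S0. Qed.

Lemma le_inf_ge S z : (S !=set0)%classic -> (forall s, S s -> z <= s) -> z <= inf S.
Proof. by move=> Sn0 Sz; apply: lb_le_inf. Qed.

Lemma le_infD S T z : (S !=set0)%classic -> (T !=set0)%classic ->
  (forall s t, S s -> T t -> z <= s + t) -> z <= inf S + inf T.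
Proof.
move=> S0 T0 h; rewrite -lerBlDr; apply: le_inf_ge => // s Ss.
rewrite lerBlDr -lerBlDl; apply: le_inf_ge => // t Tt.
by rewrite lerBlDl; exact: h.
Qed.

Lemma le_infM S T z : (S !=set0)%classic -> (T !=set0)%classic ->
  (forall s, S s -> 0 <= s) -> (forall t, T t -> 0 <= t) ->
  (forall s t, S s -> T t -> z <= s * t) -> z <= inf S * inf T.
Proof.
move=> S0 T0 Sp Tp h.
have iT0 : 0 <= inf T by exact: le_inf_ge.
have key s : S s -> z <= s * inf T.
  move=> Ss; have := Sp s Ss; rewrite le_eqVlt => /orP[/eqP s0|s0].
    have [t Tt] := T0.
    by rewrite -s0 mul0r; have := h s t Ss Tt; rewrite -s0 mul0r.
  rewrite -ler_pdivrMl//; apply: le_inf_ge => // t Tt.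
  by rewrite ler_pdivrMl//; exact: h.
move: iT0; rewrite le_eqVlt => /orP[/eqP it0|it0].
  by have [s Ss] := S0; have := key s Ss; rewrite -it0 !mulr0.
rewrite -ler_pdivrMr//; apply: le_inf_ge => // s Ss.
by rewrite ler_pdivrMr//; exact: key.
Qed.

(** Bernoulli's inequality makes the powers of [y / x > 1] unbounded. *)
Lemma le_of_exp_bound C x y : 0 <= x ->
  (forall n, y ^+ n <= C * x ^+ n) -> y <= x.
Proof.
move=> x0 h; rewrite leNgt; apply/negP => xy.
have [x00|xn0] := eqVneq x 0.
  have := h 1%N; rewrite !expr1 x00 mulr0 => y0.
  by move: xy; rewrite x00 ltNge y0.
have xp : 0 < x by rewrite lt_def xn0.
pose d := y / x - 1.
have d0 : 0 < d by rewrite subr_gt0 ltr_pdivlMr// mul1r.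
have bern n : 1 + n%:R * d <= (1 + d) ^+ n.
  elim: n => [|n IH]; first by rewrite mul0r addr0 expr0.
  rewrite exprS; have d1 : 0 <= 1 + d by lra.
  apply: le_trans (ler_wpM2l d1 IH).
  have : 0 <= n%:R * d * d by rewrite !mulr_ge0// ltW.
  rewrite -natr1; lra.
have hd n : (1 + d) ^+ n <= C.
  by rewrite /d addrC subrK expr_div_n ler_pdivrMr ?exprn_gt0.
have [n hn] : exists n : nat, C / d < n%:R.
  by exists (Num.bound (C / d)); apply: archi_boundP; rewrite divr_ge0 ?ltW//
    (lt_le_trans _ (hd 0%N)).
have := le_trans (bern n) (hd n).
by move: hn; rewrite ltr_pdivrMr//; lra.
Qed.

End RealHelpers.

Section Seminorm.
Variables (R : realType) (E : fieldType).

(** Submultiplicative seminorms; on a field they vanish only at [0]. *)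
Record is_seminorm (p : E -> R) : Prop := IsSeminorm {
  sn_ge0 : forall x, 0 <= p x;
  sn_D : forall x y, p (x + y) <= p x + p y;
  sn_M : forall x y, p (x * y) <= p x * p y;
  sn_1 : 1 <= p 1;
  sn_0 : p 0 = 0
}.

(** The seminorms constructed below are all infima of sets of bounds, one set
    for each element; the two conditions on [S] are what makes such infima
    subadditive and submultiplicative. *)
Lemma inf_seminorm (S : E -> set R) :
  (forall x, S x !=set0)%classic -> (forall x s, S x s -> 0 <= s) ->
  (forall x y s t, S x s -> S y t -> exists2 u, S (x + y) u & u <= s + t) ->
  (forall x y s t, S x s -> S y t -> exists2 u, S (x * y) u & u <= s * t) ->
  (forall s, S 1 s -> 1 <= s) -> inf (S 0) <= 0 ->
  is_seminorm (fun x => inf (S x)).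
Proof.
move=> Sn0 Sp SD SM S1 S0; split.
- by move=> x; apply: le_inf_ge => // s; exact: Sp.
- move=> x y; apply: le_infD => // s t Ss Tt.
  have [u Su us] := SD _ _ _ _ Ss Tt; apply: le_trans us.
  by apply: inf_le_mem => //; exact: Sp.
- move=> x y; apply: le_infM => //; try exact: Sp.
  move=> s t Ss Tt; have [u Su us] := SM _ _ _ _ Ss Tt; apply: le_trans us.
  by apply: inf_le_mem => //; exact: Sp.
- exact: le_inf_ge.
- by apply/eqP; rewrite eq_le S0; apply: le_inf_ge => // s; exact: Sp.
Qed.

Lemma sn_gt0 p x : is_seminorm p -> x != 0 -> 0 < p x.
Proof.
move=> sp x0; rewrite lt_def sn_ge0// andbT; apply/eqP => px0.
have := sn_1 sp; have := sn_M sp x x^-1; rewrite divff// px0 mul0r => h1 h2.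
by have := le_trans h2 h1; rewrite ler10.
Qed.

Lemma sn_exp p x n : is_seminorm p -> p (x ^+ n.+1) <= p x ^+ n.+1.
Proof.
move=> sp; elim: n => [//|n IH]; rewrite exprS [leRHS]exprS.
by apply: le_trans (sn_M sp _ _) _; rewrite ler_wpM2l// sn_ge0.
Qed.

(** By Zorn's lemma: the pointwise infimum of a chain is again a seminorm, as
    two members of a chain can be replaced by the smaller one. *)
Lemma minimal_seminorm p0 : is_seminorm p0 ->
  exists p, [/\ is_seminorm p, forall x, p x <= p0 x &
    forall q, is_seminorm q -> (forall x, q x <= p x) -> forall x, q x = p x].
Proof.
move=> sp0.
pose T := {p : E -> R | is_seminorm p /\ forall x, p x <= p0 x}.
pose mk p sp ple : T := exist _ p (conj sp ple).
pose le (p q : T) := `[< forall x, sval q x <= sval p x >].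
have [||||t tmax] := @Zorn T le.
- by move=> t; apply/asboolP.
- move=> r s t /asboolP rs /asboolP st; apply/asboolP => x.
  exact: le_trans (st x) (rs x).
- move=> [s s'] [t t'] /asboolP/= st /asboolP/= ts; apply: eq_exist.
  by apply: funext => x; apply/eqP; rewrite eq_le st ts.
- move=> A tot; have [[a Aa]|/forallNP An0] := pselect (exists a, A a); last first.
    by exists (mk p0 sp0 (fun x => lexx _)) => s /An0.
  pose S x : set R := [set r | exists2 t, A t & r = sval t x]%classic.
  have Sge0 x s : S x s -> 0 <= s.
    by move=> [t At ->]; apply: sn_ge0; case: (svalP t).
  have Sn0 x : (S x !=set0)%classic by exists (sval a x); exists a.
  have chain x y s t : S x s -> S y t -> exists w, [/\ A w, sval w x <= s & sval w y <= t].
    move=> [u Au ->] [w Aw ->]; have [/asboolP uw|/asboolP wu] := tot u w Au Aw.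
      by exists w; split.
    by exists u; split.
  have sq : is_seminorm (fun x => inf (S x)).
    apply: inf_seminorm => //.
    - move=> x y s t /chain h /h[w [Aw ws wt]].
      exists (sval w (x + y)); first by exists w.
      apply: le_trans (lerD ws wt); apply: sn_D; by case: (svalP w).
    - move=> x y s t /chain h /h[w [Aw ws wt]].
      have [sw _] := svalP w.
      exists (sval w (x * y)); first by exists w.
      apply: le_trans (ler_pM _ _ ws wt); rewrite ?sn_ge0//; exact: sn_M.
    - by move=> s [t At ->]; apply: sn_1; case: (svalP t).
    - apply: inf_le_mem; first exact: Sge0.
      by exists a => //; rewrite sn_0//; case: (svalP a).
  have qa x t : A t -> inf (S x) <= sval t x.
    by move=> At; apply: inf_le_mem; [exact: Sge0 | exists t].
  have qle x : inf (S x) <= p0 x.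
    by apply: le_trans (qa x a Aa) _; case: (svalP a).
  exists (mk _ sq qle) => s As; apply/asboolP => x /=.
  exact: qa.
exists (sval t); have [st tle] := svalP t; split => // q sq qt x.
have qle y : q y <= p0 y by exact: le_trans (qt y) (tle y).
have /(congr1 sval)/= <- // : mk q sq qle = t.
by apply: tmax; apply/asboolP.
Qed.

Lemma sn_sum p I (r : seq I) (F : I -> E) : is_seminorm p ->
  p (\sum_(i <- r) F i) <= \sum_(i <- r) p (F i).
Proof.
move=> sp; elim: r => [|i r IH]; first by rewrite !big_nil sn_0.
by rewrite !big_cons (le_trans (sn_D sp _ _))// lerD2l.
Qed.

Lemma sn_mulrn p x n : is_seminorm p -> p (x *+ n) <= p x *+ n.
Proof.
move=> sp; elim: n => [|n IH]; first by rewrite !mulr0n sn_0.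
by rewrite !mulrS (le_trans (sn_D sp _ _))// lerD2l.
Qed.

(** The exponential rates that dominate the powers of [x]; their infimum is the
    spectral radius of [x]. *)
Definition growth_rate (p : E -> R) x : set R :=
  [set t | 0 < t /\ exists C, forall n, p (x ^+ n) <= C * t ^+ n]%classic.

Lemma growth_rate_const p x t (C : R) : is_seminorm p ->
  (forall n, p (x ^+ n) <= C * t ^+ n) -> 0 <= C.
Proof. by move=> sp /(_ 0%N); rewrite expr0 mulr1; apply: le_trans; exact: sn_ge0. Qed.

(** The binomial formula: the coefficients of [(x + y)^n] add up in the same
    way as those of [(s + t)^n]. *)
Lemma growth_rateD p x y s t : is_seminorm p ->
  growth_rate p x s -> growth_rate p y t -> growth_rate p (x + y) (s + t).
Proof.
move=> sp [s0 [C hC]] [t0 [D hD]]; split; first exact: addr_gt0.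
exists (C * D) => n; rewrite !exprDn mulr_sumr.
apply: le_trans (sn_sum _ _ sp) _; apply: ler_sum => i _.
apply: le_trans (sn_mulrn _ _ sp) _; rewrite mulrnAr lerMn2r; apply/orP; right.
apply: le_trans (sn_M sp _ _) _; rewrite mulrACA.
by apply: ler_pM; rewrite ?sn_ge0.
Qed.

Lemma growth_rateM p x y s t : is_seminorm p ->
  growth_rate p x s -> growth_rate p y t -> growth_rate p (x * y) (s * t).
Proof.
move=> sp [s0 [C hC]] [t0 [D hD]]; split; first exact: mulr_gt0.
exists (C * D) => n; rewrite !exprMn mulrACA.
apply: le_trans (sn_M sp _ _) _.
by apply: ler_pM; rewrite ?sn_ge0.
Qed.

Lemma growth_rate_gt p x t : is_seminorm p -> p x < t -> growth_rate p x t.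
Proof.
move=> sp xt; have t0 : 0 < t by apply: le_lt_trans xt; exact: sn_ge0.
split=> //; exists (p 1) => -[|n]; first by rewrite !expr0 mulr1.
apply: le_trans (sn_exp _ _ sp) _.
apply: (@le_trans _ _ (t ^+ n.+1)); first by apply: lerXn2r; rewrite ?nnegrE ?(sn_ge0 sp) ?ltW.
by rewrite ler_peMl ?sn_1// exprn_ge0// ltW.
Qed.

(** Odd powers cost one more factor [p x], which the constant absorbs. *)
Lemma growth_rate_sqr p x t : is_seminorm p -> 0 < t ->
  growth_rate p (x ^+ 2) (t ^+ 2) -> growth_rate p x t.
Proof.
move=> sp t0 [_ [C hC]]; have C0 := growth_rate_const sp hC.
split=> //; exists (C + C * p x / t) => n.
have x0 := sn_ge0 sp x.
have Cx : 0 <= C * p x / t by rewrite !mulr_ge0// invr_ge0 ltW.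
have hev m : p (x ^+ m.*2) <= C * t ^+ m.*2 by rewrite -mul2n !exprM.
rewrite -(odd_double_half n); case: (odd n); rewrite ?add0n ?add1n.
  rewrite !exprS; apply: le_trans (sn_M sp _ _) _.
  apply: le_trans (ler_wpM2l x0 (hev _)) _.
  set u := t ^+ _; have u0 : 0 <= u by rewrite exprn_ge0// ltW.
  have -> : p x * (C * u) = C * p x / t * (t * u) by field; rewrite gt_eqF.
  by rewrite ler_wpM2r ?lerDr// mulr_ge0// ltW.
by apply: le_trans (hev _) _; rewrite ler_wpM2r ?lerDl// exprn_ge0// ltW.
Qed.

Lemma spectral_seminorm p : is_seminorm p ->
  is_seminorm (fun x => inf (growth_rate p x)).
Proof.
move=> sp; apply: inf_seminorm.
- by move=> x; exists (p x + 1); apply: growth_rate_gt => //; rewrite ltrDl.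
- by move=> x s [/ltW].
- by move=> x y s t Ss St; exists (s + t) => //; exact: growth_rateD.
- by move=> x y s t Ss St; exists (s * t) => //; exact: growth_rateM.
- move=> s [s0 [C hC]]; apply: (@le_of_exp_bound _ C); first exact: ltW.
  by move=> n; rewrite expr1n (le_trans (sn_1 sp))// -(expr1n _ n).
- apply/ler_addgt0Pl => e e0; rewrite addr0; apply: inf_le_mem => [s [/ltW]//|].
  by apply: growth_rate_gt => //; rewrite sn_0.
Qed.

Lemma spectral_le p x : is_seminorm p -> inf (growth_rate p x) <= p x.
Proof.
move=> sp; apply/ler_addgt0Pl => e e0; apply: inf_le_mem => [s [/ltW]//|].
by apply: growth_rate_gt => //; rewrite ltrDr.
Qed.

(** A minimal seminorm equals its own spectral seminorm, whose value at [x^2]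
    is the square of its value at [x]. *)
Lemma minimal_sqr p :
  is_seminorm p ->
  (forall q, is_seminorm q -> (forall x, q x <= p x) -> forall x, q x = p x) ->
  forall x, p (x ^+ 2) = p x ^+ 2.
Proof.
move=> sp pmin x.
have spec y : p y = inf (growth_rate p y).
  by symmetry; apply: (pmin _ (spectral_seminorm sp)) => z; exact: spectral_le.
apply/eqP; rewrite eq_le sn_exp//= [leRHS]spec; apply: le_inf_ge.
  by exists (p (x ^+ 2) + 1); apply: growth_rate_gt => //; rewrite ltrDl.
move=> s Ss; have s0 : 0 < s by case: Ss.
have es := sqr_sqrtr (ltW s0); rewrite -es in Ss; rewrite -es.
apply: lerXn2r; rewrite ?nnegrE ?(sn_ge0 sp) ?sqrtr_ge0//.
rewrite spec; apply: inf_le_mem => [t [/ltW]//|].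
by apply: growth_rate_sqr => //; rewrite sqrtr_gt0.
Qed.

(** Repeated squaring settles the exponents [2^k]; any [m] is below such an
    exponent, and submultiplicativity transfers the equality to [m]. *)
Lemma minimal_exp p x n : is_seminorm p -> (forall y, p (y ^+ 2) = p y ^+ 2) ->
  x != 0 -> p (x ^+ n) = p x ^+ n.
Proof.
move=> sp psqr x0; have p1 : p 1 = 1.
  have := psqr 1; rewrite expr1n => /esym/eqP.
  rewrite -subr_eq0 -[X in _ - X]mulr1 expr2 -mulrBr mulf_eq0 subr_eq0.
  by case/orP=> [/eqP h|/eqP//]; have := sn_1 sp; rewrite h ler10.
case: n => [|n]; first by rewrite !expr0.
apply/eqP; rewrite eq_le sn_exp//=; set m := n.+1.
have ppow k : p (x ^+ (2 ^ k)) = p x ^+ (2 ^ k).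
  by elim: k => [|k IH]; rewrite ?expr1// expnSr !exprM psqr IH.
have mk : (m < 2 ^ m)%N by rewrite ltn_expl.
have := ppow m; have -> : (2 ^ m = (2 ^ m - m.+1).+1 + m)%N by rewrite addSn -addnS subnK.
rewrite !exprD => e.
have xp : 0 < p x by exact: sn_gt0.
rewrite -(ler_pM2l (exprn_gt0 (2 ^ m - m.+1).+1 xp)) -e.
apply: le_trans (sn_M sp _ _) _; rewrite ler_wpM2r ?sn_ge0//.
exact: sn_exp.
Qed.

(** Their infimum, the limit of a nonincreasing sequence, is the function of [g]
    obtained from [p] by forcing multiplication by [f] to scale values by [p f]. *)
Definition ratios (p : E -> R) (f g : E) : set R :=
  [set t | exists n, t = p (g * f ^+ n) / p f ^+ n]%classic.

Lemma ratios_decr p f g n m : is_seminorm p -> f != 0 ->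
  p (g * f ^+ (n + m)) / p f ^+ (n + m) <= p (g * f ^+ n) / p f ^+ n.
Proof.
move=> sp f0; have fp := sn_gt0 sp f0; elim: m => [|m IH]; first by rewrite addn0.
apply: le_trans IH; rewrite addnS !exprSr ler_pdivrMr ?mulr_gt0 ?exprn_gt0//.
by rewrite [leRHS]mulrA divfK ?gt_eqF ?exprn_gt0// mulrA sn_M.
Qed.

(** The infimum of the ratios is a seminorm below [p], with value at least [1]
    at [1] because [p] respects powers; minimality identifies it with [p], and
    then the ratio with [n = 1] gives [p g <= p (g f) / p f]. *)
Lemma minimal_mul p : is_seminorm p ->
  (forall q, is_seminorm q -> (forall x, q x <= p x) -> forall x, q x = p x) ->
  forall f g, p (f * g) = p f * p g.
Proof.
move=> sp pmin f g; have [->|f0] := eqVneq f 0; first by rewrite !mul0r sn_0// mul0r.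
have fp := sn_gt0 sp f0; have fn0 n : 0 < p f ^+ n by exact: exprn_gt0.
have pexp n : p (f ^+ n) = p f ^+ n by apply: minimal_exp => //; exact: minimal_sqr.
have rge0 x s : ratios p f x s -> 0 <= s.
  by move=> [n ->]; rewrite divr_ge0 ?sn_ge0// ltW.
have rle x n : inf (ratios p f x) <= p (x * f ^+ n) / p f ^+ n.
  by apply: inf_le_mem; [exact: rge0 | exists n].
have sq : is_seminorm (fun x => inf (ratios p f x)).
  apply: inf_seminorm => //.
  - by move=> x; exists (p (x * f ^+ 0) / p f ^+ 0); exists 0%N.
  - move=> x y s t [n ->] [m ->].
    exists (p ((x + y) * f ^+ (n + m)) / p f ^+ (n + m)); first by exists (n + m)%N.
    apply: le_trans (lerD (ratios_decr x n m sp f0) (ratios_decr y m n sp f0)).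
    by rewrite (addnC m) -mulrDl ler_pM2r ?invr_gt0// mulrDl sn_D.
  - move=> x y s t [n ->] [m ->].
    exists (p ((x * y) * f ^+ (n + m)) / p f ^+ (n + m)); first by exists (n + m)%N.
    by rewrite mulf_div -exprD ler_pM2r ?invr_gt0// exprD mulrACA sn_M.
  - by move=> s [n ->]; rewrite mul1r pexp divff ?gt_eqF.
  - by rewrite (le_trans (rle 0 0%N))// mul0r sn_0// mul0r.
have qp x : inf (ratios p f x) = p x.
  by apply: (pmin _ sq) => y; have := rle y 0%N; rewrite expr0 divr1 mulr1.
apply/eqP; rewrite eq_le sn_M//= -ler_pdivlMl// -qp mulrC.
by have := rle g 1%N; rewrite !expr1 mulrC [g * f]mulrC [X in _ <= X]mulrC.
Qed.

(** In Berkovich's terms, the spectrum of a normed ring is not empty; here the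
    ring is a field, on which a minimal seminorm below [p0] is multiplicative. *)
Lemma seminorm_dominates_absval p0 : is_seminorm p0 ->
  exists b : absval R E, forall x, b x <= p0 x.
Proof.
move=> /minimal_seminorm[p [sp pp0 pmin]].
have peq0 x : p x = 0 <-> x = 0.
  split=> [px0|->]; last exact: sn_0.
  by apply/eqP; apply: contra_eqT px0 => x0; rewrite gt_eqF// sn_gt0.
by exists (Absval (sn_ge0 sp) peq0 (sn_D sp) (minimal_mul sp pmin)).
Qed.

End Seminorm.

Section AbsvalPowers.
Variables (R : realType) (E : fieldType).

Lemma avX (b : absval R E) x n : b (x ^+ n) = b x ^+ n.
Proof. by elim: n => [|n IH]; rewrite ?av1// !exprS avM IH. Qed.

Lemma av_sum (b : absval R E) I (r : seq I) (F : I -> E) :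
  b (\sum_(i <- r) F i) <= \sum_(i <- r) b (F i).
Proof.
elim: r => [|i r IH]; first by rewrite !big_nil av0.
by rewrite !big_cons (le_trans (avD b _ _))// lerD2l.
Qed.

Lemma av_dist (b : absval R E) x y : `|b x - b y| <= b (x - y).
Proof.
have h z t : b z - b t <= b (z - t) by have := avD b (z - t) t; rewrite subrK; lra.
rewrite ler_norml h andbT -[x - y]opprB avN.
by have := h y x; lra.
Qed.

End AbsvalPowers.

Lemma absval_ext_eq (R : realType) (F E : fieldType) (f : {rmorphism F -> E})
  (a : absval R F) (b c : absval_ext f a) : (forall x, b x = c x) -> b = c.
Proof.
case: b c => [[b b1 b2 b3 b4] b5] [[c c1 c2 c3 c4] c5] /= e.
have {}e : b = c by exact: funext.
move: b1 b2 b3 b4 b5; rewrite e => b1 b2 b3 b4 b5.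
have e1 := Prop_irrelevance b1 c1; have e2 := Prop_irrelevance b2 c2.
have e3 := Prop_irrelevance b3 c3; have e4 := Prop_irrelevance b4 c4.
move: b5; rewrite e1 e2 e3 e4 => b5; congr AbsvalExt; exact: Prop_irrelevance.
Qed.

(** On powers of [x] the constant disappears, which gives [b x <= a x]; the
    inverse of [x] gives the other inequality. *)
Lemma absval_eq_of_bound (R : realType) (F : fieldType) (a b : absval R F) (C : R) :
  (forall x, b x <= C * a x) -> forall x, b x = a x.
Proof.
move=> h; have le x : b x <= a x.
  apply: (@le_of_exp_bound _ C); first exact: av_ge0.
  by move=> n; rewrite -!avX.
move=> x; have [->|x0] := eqVneq x 0; first by rewrite !av0.
apply/eqP; rewrite eq_le le /=.
by have := le x^-1; rewrite !avV lef_pV2// posrE av_gt0.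
Qed.

Definition av_restrict (R : realType) (F E : fieldType) (f : {rmorphism F -> E})
  (b : absval R E) : absval R F.
Proof.
exists (b \o f) => /= [x|x|x y|x y].
- exact: av_ge0.
- rewrite av_eq0; split=> [/eqP|->]; last exact: rmorph0.
  by rewrite fmorph_eq0 => /eqP.
- by rewrite rmorphD; exact: avD.
- by rewrite rmorphM; exact: avM.
Defined.

(** The norm given by a basis, suitably rescaled, is submultiplicative, and an
    absolute value that it dominates has to agree with [a] on the base. *)
Lemma absval_extension (R : realType) (F : fieldType) (E : fieldExtType F)
  (a : absval R F) : exists b : absval R E, forall x, b x%:A = a x.
Proof.
pose e := vbasis {:E}; pose c (i : 'I_(\dim {:E})) x := coord e i x.
have decomp x : x = \sum_i c i x *: e`_i by exact/coord_vbasis/memvf.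
pose N x := \sum_i a (c i x).
have N0 x : 0 <= N x by apply: sumr_ge0 => i _; exact: av_ge0.
have ND x y : N (x + y) <= N x + N y.
  rewrite /N -big_split /=; apply: ler_sum => i _.
  by rewrite /c linearD; exact: avD.
have NZ l x : N (l *: x) = a l * N x.
  by rewrite /N mulr_sumr; apply: eq_bigr => i _; rewrite /c linearZ /= avM.
have N00 : N 0 = 0 by rewrite -(scale0r 0) NZ av0 mul0r.
have Nsum I (r : seq I) (G : I -> E) : N (\sum_(i <- r) G i) <= \sum_(i <- r) N (G i).
  elim: r => [|i r IH]; first by rewrite !big_nil N00.
  by rewrite !big_cons (le_trans (ND _ _))// lerD2l.
have N_inj x : N x = 0 -> x = 0.
  move=> n1; rewrite (decomp x) big1// => i _; suff -> : c i x = 0 by rewrite scale0r.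
  apply/(av_eq0 a); have /eqP := n1; rewrite psumr_eq0 => [|j _]; last exact: av_ge0.
  by move=> /allP/(_ i); rewrite mem_index_enum => /(_ isT)/eqP.
have Ndecomp x z : N (z * x) <= \sum_i a (c i x) * N (z * e`_i).
  rewrite {1}(decomp x) mulr_sumr; apply: le_trans (Nsum _ _ _) _.
  by apply: ler_sum => i _; rewrite -scalerAr NZ.
have NE x : N x = \sum_i a (c i x) by [].
clearbody N.
(* [D] bounds the structure constants, so that [D * N] is submultiplicative. *)
pose D := \sum_(i < \dim {:E}) \sum_(j < \dim {:E}) N (e`_i * e`_j) + 1.
have D1 : 1 <= D.
  by rewrite lerDr; apply: sumr_ge0 => i _; apply: sumr_ge0 => j _.
have D0 : 0 < D by exact: lt_le_trans D1.
have Dij (i j : 'I_(\dim {:E})) : N (e`_i * e`_j) <= D.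
  rewrite /D (bigD1 i)//= (bigD1 j)//= -!addrA lerDl !addr_ge0//.
    by apply: sumr_ge0 => l _.
  by apply: sumr_ge0 => l _; apply: sumr_ge0 => l' _.
have NM x y : N (x * y) <= D * N x * N y.
  rewrite mulrC; apply: le_trans (Ndecomp _ _) _.
  have -> : D * N x * N y = \sum_i a (c i x) * (D * N y).
    by rewrite -mulr_suml -NE; ring.
  apply: ler_sum => i _; rewrite ler_wpM2l ?av_ge0// mulrC.
  apply: le_trans (Ndecomp _ _) _; rewrite (NE y) mulr_sumr; apply: ler_sum => j _.
  by rewrite mulrC ler_wpM2r ?av_ge0.
have N1 : 0 < N 1.
  by rewrite lt_def N0 andbT; apply/eqP => /N_inj/eqP; rewrite oner_eq0.
have sN : is_seminorm (fun x => D * N x).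
  split.
  - by move=> x; rewrite mulr_ge0// ltW.
  - by move=> x y; rewrite -mulrDr ler_pM2l.
  - by move=> x y; rewrite [leRHS]mulrACA -[leRHS]mulrA ler_pM2l// mulrA.
  - have := NM 1 1; rewrite mulr1 => h.
    by rewrite -(ler_pM2r N1) mul1r.
  - by rewrite N00 mulr0.
have [b bN] := seminorm_dominates_absval sN; exists b => x.
apply: (@absval_eq_of_bound R F a (av_restrict (in_alg E) b) (D * N 1)) => y.
by rewrite /= (le_trans (bN _))// NZ mulrA mulrAC.
Qed.

(** * Completions *)

Section Limits.
Variable R : realType.
Implicit Types (s t : nat -> R) (l m : R).

(** Convergence is spelled out so as to match the definition of Cauchy and null
    sequences for an absolute value. *)
Definition tends s l :=
  forall e, 0 < e -> exists N, forall n, (N <= n)%N -> `|s n - l| < e.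

Lemma tends_cst l : tends (fun=> l) l.
Proof. by move=> e e0; exists 0%N => n _; rewrite subrr normr0. Qed.

Lemma tends_both s t l m e : tends s l -> tends t m -> 0 < e ->
  exists N, forall n, (N <= n)%N -> `|s n - l| < e /\ `|t n - m| < e.
Proof.
move=> sl tm e0; have [[N hN] [M hM]] := (sl e e0, tm e e0).
by exists (maxn N M) => n; rewrite geq_max => /andP[/hN ? /hM].
Qed.

Lemma tends_le s t l m : tends s l -> tends t m -> (forall n, s n <= t n) -> l <= m.
Proof.
move=> sl tm st; apply/ler_addgt0Pl => e e0.
have [N hN] := tends_both sl tm (divr_gt0 e0 (ltr0Sn _ 1)).
have [] := hN N (leqnn N); rewrite !ltr_norml => /andP[h1 h2] /andP[h3 h4].
by have := st N; lra.
Qed.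

Lemma tends_unique s l m : tends s l -> tends s m -> l = m.
Proof. by move=> sl sm; apply/eqP; rewrite eq_le !(tends_le (s := s) (t := s)). Qed.

Lemma tendsD s t l m : tends s l -> tends t m -> tends (fun n => s n + t n) (l + m).
Proof.
move=> sl tm e e0; have [N hN] := tends_both sl tm (divr_gt0 e0 (ltr0Sn _ 1)).
exists N => n /hN[]; rewrite !ltr_norml => /andP[h1 h2] /andP[h3 h4].
by apply/andP; split; lra.
Qed.

Lemma tendsM s t l m : tends s l -> tends t m -> tends (fun n => s n * t n) (l * m).
Proof.
move=> sl tm e e0; pose d := Num.min 1 (e / (1 + `|l| + `|m|)).
have B0 : 0 < 1 + `|l| + `|m| by rewrite -addrA ltr_wpDr// addr_ge0.
have d0 : 0 < d by rewrite lt_min ltr01 divr_gt0.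
have d1 : d <= 1 by rewrite ge_min lexx.
have dB : d * (1 + `|l| + `|m|) <= e.
  by rewrite -ler_pdivlMr// ge_min lexx orbT.
have [N hN] := tends_both sl tm d0; exists N => n /hN[h1 h2].
have -> : s n * t n - l * m = (s n - l) * (t n - m) + (l * (t n - m) + m * (s n - l)) by ring.
apply: le_lt_trans (ler_normD _ _) _; apply: le_lt_trans (lerD (lexx _) (ler_normD _ _)) _.
rewrite !normrM; apply: lt_le_trans dB.
have : `|s n - l| * `|t n - m| < d * 1.
  by apply: ltr_pM => //; exact: lt_le_trans d1.
have : `|l| * `|t n - m| <= `|l| * d by rewrite ler_wpM2l// ltW.
have : `|m| * `|s n - l| <= `|m| * d by rewrite ler_wpM2l// ltW.
by rewrite !mulrDr; lra.
Qed.

(** The limit is the supremum of the eventual lower bounds. *)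
Lemma cauchy_tends s :
  (forall e, 0 < e -> exists N, forall m n : nat, (N <= m)%N -> (N <= n)%N -> `|s m - s n| < e) ->
  exists l, tends s l.
Proof.
move=> cs; pose A := [set r | exists N, forall n, (N <= n)%N -> r <= s n]%classic.
have ubA e N : 0 < e -> (forall m n : nat, (N <= m)%N -> (N <= n)%N -> `|s m - s n| < e) ->
    (ubound A) (s N + e).
  move=> e0 hN r [M hM].
  have := hM (maxn M N) (leq_maxl _ _).
  by have := hN (maxn M N) N (leq_maxr _ _) (leqnn _); rewrite ltr_norml => /andP[]; lra.
have memA e N : 0 < e -> (forall m n : nat, (N <= m)%N -> (N <= n)%N -> `|s m - s n| < e) ->
    A (s N - e).
  move=> e0 hN; exists N => n Nn.
  by have := hN n N Nn (leqnn _); rewrite ltr_norml => /andP[]; lra.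
have supA : has_sup A.
  have [N hN] := cs 1 ltr01; split; first by exists (s N - 1); exact: memA.
  by exists (s N + 1); exact: ubA.
exists (sup A) => e e0; have e2 : 0 < e / 2 by rewrite divr_gt0.
have [N hN] := cs _ e2; exists N => n Nn.
have h1 : sup A <= s N + e / 2 by apply: ge_sup; [case: supA | exact: ubA].
have h2 : s N - e / 2 <= sup A by apply: ub_le_sup; [case: supA | exact: memA].
have := hN n N Nn (leqnn _); rewrite !ltr_norml => /andP[h3 h4]; apply/andP.
by split; lra.
Qed.

Lemma invS_small (e : R) : 0 < e ->
  exists N : nat, forall n, (N <= n)%N -> n.+1%:R^-1 < e.
Proof.
move=> e0; exists (Num.bound e^-1) => n hn.
rewrite invf_plt ?posrE//; apply: lt_le_trans (archi_boundP _) _.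
  by rewrite invr_ge0 ltW.
by rewrite ler_nat leqW.
Qed.

End Limits.

Section CompletionTheory.
Variables (R : realType) (F : fieldType) (a : absval R F).
Local Notation C := (completion a).
Implicit Types (c d : C) (u : cauchy_ring a).

Lemma compl_limit_ex c : exists l, tends (fun n => a (sr_val (resid_repr c) n)) l.
Proof.
apply: cauchy_tends => e e0; have /asboolP/(_ e e0)[N hN] := sr_valP (resid_repr c).
by exists N => m n Nm Nn; apply: le_lt_trans (av_dist _ _ _) (hN m n Nm Nn).
Qed.

Definition compl_fun c : R := projT1 (cid (compl_limit_ex c)).

(** The limit does not depend on the representative, because null sequences do
    not change it. *)
Lemma compl_funE u : tends (fun n => a (sr_val u n)) (compl_fun (resid (null_max a) u)).
Proof.
rewrite /compl_fun; case: cid => l /=; set r := resid_repr _ => hl e e0.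
have nu : null_max a (u - r) by rewrite -resid_eq /r resid_reprK.
have e2 : 0 < e / 2 by rewrite divr_gt0.
move/asboolP: nu => /(_ _ e2)[N hN]; have [M hM] := hl _ e2.
exists (maxn N M) => n; rewrite geq_max => /andP[/hN h1 /hM h2].
move: h1; rewrite sr_valB fctE => h1.
have := av_dist a (sr_val u n) (sr_val r n); move: h2; rewrite !ltr_norml ler_norml.
by move=> /andP[? ?] /andP[? ?]; apply/andP; split; lra.
Qed.

Lemma compl_ge0 c : 0 <= compl_fun c.
Proof.
rewrite -[c]resid_reprK; apply: tends_le (tends_cst 0) (compl_funE _) _ => n.
exact: av_ge0.
Qed.

Lemma compl_eq0 c : compl_fun c = 0 <-> c = 0.
Proof.
rewrite -[c]resid_reprK; set u := resid_repr c; have hu := compl_funE u.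
split=> [e0|/eqP]; last first.
  rewrite resid_eq0 => /asboolP nu; apply: tends_unique hu _ => e /nu[N hN].
  by exists N => n /hN; rewrite subr0 ger0_norm ?av_ge0.
apply/eqP; rewrite resid_eq0; apply/asboolP => e /hu[N hN].
by exists N => n /hN; rewrite e0 subr0 ger0_norm ?av_ge0.
Qed.

Lemma compl_D c d : compl_fun (c + d) <= compl_fun c + compl_fun d.
Proof.
rewrite -[c]resid_reprK -[d]resid_reprK -rmorphD.
apply: tends_le (compl_funE _) (tendsD (compl_funE _) (compl_funE _)) _ => n.
by rewrite sr_valD fctE avD.
Qed.

Lemma compl_M c d : compl_fun (c * d) = compl_fun c * compl_fun d.
Proof.
rewrite -[c]resid_reprK -[d]resid_reprK -rmorphM.
apply: tends_unique (compl_funE _) _.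
have := tendsM (compl_funE (resid_repr c)) (compl_funE (resid_repr d)).
by congr tends; apply: funext => n; rewrite sr_valM fctE avM.
Qed.

Definition compl_av : absval R C := Absval compl_ge0 compl_eq0 compl_D compl_M.

Lemma cst_cauchy (x : F) : cauchy_pred a (fun=> x).
Proof. by apply/asboolP => e e0; exists 0%N => m n _ _; rewrite subrr av0. Qed.

Definition cst_seq (x : F) : cauchy_ring a := SubringElt (A := cauchy_ring a) (cst_cauchy x).

Definition to_compl (x : F) : C := resid (null_max a) (cst_seq x).

Lemma to_compl_zmod : zmod_morphism to_compl.
Proof.
move=> x y; rewrite /to_compl -rmorphB; congr resid; apply: sr_val_inj.
by rewrite sr_valB.
Qed.
Lemma to_compl_monoid : monoid_morphism to_compl.
Proof.
split; first by rewrite -(rmorph1 (resid (null_max a))); congr resid; apply: sr_val_inj; rewrite sr_val1.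
move=> x y; rewrite /to_compl -rmorphM; congr resid; apply: sr_val_inj.
by rewrite sr_valM.
Qed.
HB.instance Definition _ := GRing.isZmodMorphism.Build F C to_compl to_compl_zmod.
HB.instance Definition _ := GRing.isMonoidMorphism.Build F C to_compl to_compl_monoid.

Lemma to_complE x : compl_av (to_compl x) = a x.
Proof.
apply: (@tends_unique _ (fun=> a x)); last exact: tends_cst.
exact: (compl_funE (cst_seq x)).
Qed.

Lemma compl_close u e : 0 < e -> exists N, forall n, (N <= n)%N ->
  compl_av (resid (null_max a) u - to_compl (sr_val u n)) < e.
Proof.
move=> e0; have e2 : 0 < e / 2 by rewrite divr_gt0.
have /asboolP/(_ _ e2)[N hN] := sr_valP u.
exists N => n Nn; rewrite /to_compl -rmorphB.
apply: (@le_lt_trans _ _ (e / 2)); last by lra.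
have [M hM] := compl_funE (u - cst_seq (sr_val u n)) e2.
apply/ler_addgt0Pl => d d0.
have [M' hM'] := compl_funE (u - cst_seq (sr_val u n)) d0.
have h1 := hM' (maxn M' N) (leq_maxl _ _).
have h2 := hN (maxn M' N) n (leq_maxr _ _) Nn.
move: h1; rewrite sr_valB fctE /= ltr_norml => /andP[h1 _].
by move: h1 h2; rewrite /compl_av /=; lra.
Qed.

Lemma compl_dense c e : 0 < e -> exists x, compl_av (c - to_compl x) < e.
Proof.
move=> /(compl_close (resid_repr c))[N hN]; exists (sr_val (resid_repr c) N).
by have := hN N (leqnn N); rewrite resid_reprK.
Qed.

End CompletionTheory.

Definition complete (R : realType) (F : fieldType) (a : absval R F) :=
  forall u : nat -> F, cauchy_pred a u ->
    exists z, forall e, 0 < e -> exists N, forall n, (N <= n)%N -> a (u n - z) < e.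

(** A Cauchy sequence of the completion is approximated, up to a null sequence,
    by a sequence in [F], whose class is the limit. *)
Lemma completion_complete (R : realType) (F : fieldType) (a : absval R F) :
  complete (compl_av a).
Proof.
move=> z /asboolP cz.
have small := @invS_small R.
have dense n : exists x, compl_av a (z n - to_compl a x) < n.+1%:R^-1.
  by apply: compl_dense; rewrite invr_gt0.
pose x n := projT1 (cid (dense n)).
have hx n : compl_av a (z n - to_compl a (x n)) < n.+1%:R^-1 by exact: (projT2 (cid (dense n))).
have cx : cauchy_pred a x.
  apply/asboolP => e e0; have e3 : 0 < e / 3 by rewrite divr_gt0.
  have [N hN] := small _ e3; have [M hM] := cz _ e3.
  exists (maxn N M) => m n; rewrite !geq_max => /andP[m1 m2] /andP[n1 n2].
  rewrite -to_complE; have -> : to_compl a (x m - x n) = to_compl a (x m) - to_compl a (x n) by exact: rmorphB.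
  have -> : to_compl a (x m) - to_compl a (x n) = (z m - z n) - ((z m - to_compl a (x m)) - (z n - to_compl a (x n))) by ring.
  have := avB (compl_av a) (z m - z n) ((z m - to_compl a (x m)) - (z n - to_compl a (x n))).
  have := avB (compl_av a) (z m - to_compl a (x m)) (z n - to_compl a (x n)).
  have := hM m n m2 n2; have := lt_trans (hx m) (hN m m1); have := lt_trans (hx n) (hN n n1).
  by lra.
exists (resid (null_max a) (SubringElt (A := cauchy_ring a) cx)) => e e0.
have e2 : 0 < e / 2 by rewrite divr_gt0.
have [N hN] := small _ e2; have [M hM] := compl_close (SubringElt (A := cauchy_ring a) cx) e2.
exists (maxn N M) => n; rewrite geq_max => /andP[/hN n1 /hM n2].
move: n2; set w := resid _ _ => n2.
have -> : z n - w = (z n - to_compl a (x n)) - (w - to_compl a (x n)) by ring.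
have := avB (compl_av a) (z n - to_compl a (x n)) (w - to_compl a (x n)).
have := lt_trans (hx n) n1.
by move: n2; rewrite -[sr_val _ n]/(x n); lra.
Qed.

Section CompletionMapTheory.
Variables (R : realType) (F E : fieldType) (iota : {rmorphism F -> E}) (a : absval R F).
Variable b : absval_ext iota a.

Lemma completion_map_to x : completion_map b (to_compl a x) = to_compl b (iota x).
Proof.
apply: etrans (residue_mapE _ _) _.
by congr resid; apply: sr_val_inj.
Qed.

Lemma completion_mapE c : compl_av b (completion_map b c) = compl_av a c.
Proof.
rewrite -[c]resid_reprK; set u := resid_repr c.
have -> : completion_map b (resid (null_max a) u) = resid (null_max b) (cauchy_map b u).
  exact: residue_mapE.
apply: tends_unique (compl_funE (cauchy_map b u)) _.
have := compl_funE u; congr tends; apply: funext => n /=.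
by rewrite ext_avE.
Qed.
End CompletionMapTheory.

(** * Finite-dimensional spaces over a complete field *)

(** Vector spaces appear below only as fields [E] above a field [F], along an
    arbitrary morphism [f]; families are functions on ordinals because the
    separable degree is defined with them. *)
Section LinearCombinations.
Variables (F E : fieldType) (f : {rmorphism F -> E}).

Definition lincomb n (e : 'I_n -> E) (c : 'I_n -> F) : E := \sum_i f (c i) * e i.

Definition lin_indep n (e : 'I_n -> E) :=
  forall c, lincomb e c = 0 -> forall i, c i = 0.

Definition in_span n (e : 'I_n -> E) (x : E) := exists c, x = lincomb e c.

Lemma lincombB n (e : 'I_n -> E) c d :
  lincomb e (fun i => c i - d i) = lincomb e c - lincomb e d.
Proof. by rewrite /lincomb -sumrB; apply: eq_bigr => i _; rewrite rmorphB mulrBl. Qed.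

Lemma lincombZ n (e : 'I_n -> E) k c :
  lincomb e (fun i => k * c i) = f k * lincomb e c.
Proof. by rewrite /lincomb mulr_sumr; apply: eq_bigr => i _; rewrite rmorphM mulrA. Qed.

Lemma lincomb_recr n (e : 'I_n.+1 -> E) c :
  lincomb e c = lincomb (e \o widen_ord (leqnSn n)) (c \o widen_ord (leqnSn n)) +
    f (c ord_max) * e ord_max.
Proof. exact: big_ord_recr. Qed.

(** [unlift ord_max] fails at the last index only, which receives [x]. *)
Definition rcons_family T n (e : 'I_n -> T) x (i : 'I_n.+1) : T :=
  oapp e x (unlift ord_max i).

Lemma rcons_family_widen T n (e : 'I_n -> T) x :
  rcons_family e x \o widen_ord (leqnSn n) = e.
Proof.
apply: funext => i; rewrite /rcons_family /=.
have -> : widen_ord (leqnSn n) i = lift ord_max i by apply: ord_inj; rewrite lift_max.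
by rewrite liftK.
Qed.

Lemma rcons_family_max T n (e : 'I_n -> T) x : rcons_family e x ord_max = x.
Proof. by rewrite /rcons_family unlift_none. Qed.

Lemma lin_indep_widen n (e : 'I_n.+1 -> E) :
  lin_indep e -> lin_indep (e \o widen_ord (leqnSn n)).
Proof.
move=> ie c c0 i; have := ie (rcons_family c 0).
rewrite lincomb_recr rcons_family_widen rcons_family_max rmorph0 mul0r addr0.
move=> /(_ c0 (widen_ord (leqnSn n) i)).
by rewrite -[rcons_family _ _ _]/((rcons_family c 0 \o widen_ord (leqnSn n)) i) rcons_family_widen.
Qed.

Lemma lin_indep_rcons n (e : 'I_n -> E) x :
  lin_indep e -> ~ in_span e x -> lin_indep (rcons_family e x).
Proof.
move=> ie nx c.
rewrite lincomb_recr rcons_family_widen rcons_family_max => c0.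
have cm : c ord_max = 0.
  apply: contrapT => /eqP cm; apply: nx.
  exists (fun i => (- (c ord_max)^-1) * c (widen_ord (leqnSn n) i)).
  rewrite lincombZ; have fcm : f (c ord_max) != 0 by rewrite fmorph_eq0.
  apply: (mulfI fcm); rewrite mulrA -rmorphM mulrN divff// rmorphN1 mulN1r.
  by apply/eqP; rewrite -addr_eq0 addrC; apply/eqP.
move: c0; rewrite cm rmorph0 mul0r addr0 => /ie c0 i.
have [j ->|->] := unliftP ord_max i; last exact: cm.
by have <- := c0 j; congr c; apply: ord_inj; rewrite lift_max.
Qed.

Lemma indep_subfamily r (g : 'I_r -> E) : exists n (e : 'I_n -> E),
  [/\ lin_indep e, forall i, exists k, e i = g k &
      forall x, in_span g x -> in_span e x].
Proof.
elim: r g => [|r IH] g.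
  by exists 0%N, g; split=> [c _ []|i|] //; exists i.
have [n [e [ie eg ge]]] := IH (g \o widen_ord (leqnSn r)); set x := g ord_max.
have eg' i : exists k, e i = g k.
  by have [k ->] := eg i; exists (widen_ord (leqnSn r) k).
have [[d xd]|nx] := pselect (in_span e x).
  exists n, e; split=> // _ [c ->]; rewrite lincomb_recr -/x.
  have [d' ->] := ge _ (ex_intro _ (c \o widen_ord (leqnSn r)) erefl).
  exists (fun i => d' i - (- c ord_max) * d i).
  by rewrite lincombB lincombZ -xd rmorphN mulNr opprK.
exists n.+1, (rcons_family e x); split=> [|i|_ [c ->]].
- exact: lin_indep_rcons.
- have [j ->|->] := unliftP ord_max i; last by exists ord_max; rewrite rcons_family_max.
  by rewrite /rcons_family liftK; exact: eg'.
rewrite lincomb_recr -/x.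
have [d' ->] := ge _ (ex_intro _ (c \o widen_ord (leqnSn r)) erefl).
exists (rcons_family d' (c ord_max)).
by rewrite lincomb_recr !rcons_family_widen !rcons_family_max.
Qed.

End LinearCombinations.

Section CompleteSpan.
Variables (R : realType) (F E : fieldType) (f : {rmorphism F -> E}).
Variables (a : absval R F) (b : absval R E).
Hypothesis bf : forall x, b (f x) = a x.
Hypothesis cF : complete a.

Lemma lincomb_le n (e : 'I_n -> E) c :
  b (lincomb f e c) <= \sum_i a (c i) * b (e i).
Proof.
by apply: le_trans (av_sum _ _ _) _; apply: ler_sum => i _; rewrite avM bf.
Qed.

(** With finitely many terms, the largest of the ranks for the terms will do. *)
Lemma lincomb_null n (e : 'I_n -> E) (u : 'I_n -> nat -> F) :
  (forall i (d : R), 0 < d -> exists N, forall m, (N <= m)%N -> a (u i m) < d) ->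
  forall d : R, 0 < d -> exists N, forall m, (N <= m)%N ->
    b (lincomb f e (u ^~ m)) < d.
Proof.
move=> hu d d0; pose B := \sum_i b (e i) + 1.
have S0 : 0 <= \sum_i b (e i) by apply: sumr_ge0 => i _; exact: av_ge0.
have B0 : 0 < B by rewrite /B; lra.
have dB : 0 < d / B by rewrite divr_gt0.
pose N i := projT1 (cid (hu i _ dB)).
exists (\max_i N i) => m Nm.
apply: le_lt_trans (lincomb_le _ _) _.
apply: (@le_lt_trans _ _ (\sum_i d / B * b (e i))).
  apply: ler_sum => i _; rewrite ler_wpM2r ?av_ge0// ltW//.
  apply: (projT2 (cid (hu i _ dB))); apply: leq_trans Nm; exact: leq_bigmax.
by rewrite -mulr_sumr mulrAC ltr_pdivrMr// ltr_pM2l// /B; lra.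
Qed.

Definition coords_bounded n (e : 'I_n -> E) :=
  exists2 C : R, 0 <= C & forall c i, a (c i) <= C * b (lincomb f e c).

(** Bounded coordinates make the coordinates of an approximating sequence
    Cauchy, and completeness of [F] provides their limits. *)
Lemma span_closed n (e : 'I_n -> E) : coords_bounded e -> forall z,
  (forall d : R, 0 < d -> exists c, b (z - lincomb f e c) < d) -> in_span f e z.
Proof.
move=> [C C0 hC] z hz.
have app m : exists c, b (z - lincomb f e c) < m.+1%:R^-1.
  by apply: hz; rewrite invr_gt0.
pose c m := projT1 (cid (app m)).
have hc m : b (z - lincomb f e (c m)) < m.+1%:R^-1 by exact: (projT2 (cid (app m))).
have lim i : exists l, forall d : R, 0 < d -> exists N, forall m, (N <= m)%N -> a (c m i - l) < d.
  apply: cF; apply/asboolP => d d0.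
  pose d' := d / 2 / (C + 1); have C1 : 0 < C + 1 by lra.
  have d'0 : 0 < d' by rewrite !divr_gt0.
  have [N hN] := invS_small d'0; exists N => m m' Nm Nm'.
  apply: le_lt_trans (hC (fun i => c m i - c m' i) i) _.
  have h : b (lincomb f e (fun i => c m i - c m' i)) < d' + d'.
    rewrite lincombB.
    have -> : lincomb f e (c m) - lincomb f e (c m') =
      (z - lincomb f e (c m')) - (z - lincomb f e (c m)) by ring.
    apply: le_lt_trans (avB _ _ _) _.
    by apply: ltrD; apply: lt_trans (hc _) (hN _ _).
  apply: (@le_lt_trans _ _ (C * (d' + d'))); first by rewrite ler_wpM2l// ltW.
  apply: (@lt_le_trans _ _ ((C + 1) * (d' + d'))); first by rewrite ltr_pM2r ?addr_gt0//; lra.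
  suff -> : (C + 1) * (d' + d') = d by [].
  by rewrite /d'; field; rewrite gt_eqF.
pose l i := projT1 (cid (lim i)).
have hl i := projT2 (cid (lim i)).
exists l; apply/eqP; rewrite -subr_eq0; apply/eqP/(av_eq0 b).
apply/eqP; rewrite eq_le av_ge0 andbT; apply/ler_addgt0Pl => d d0; rewrite addr0.
have d2 : 0 < d / 2 by rewrite divr_gt0.
have [N hN] := invS_small d2.
have [M hM] := @lincomb_null n e (fun i m => c m i - l i) hl _ d2.
have h1 := lt_trans (hc (maxn N M)) (hN _ (leq_maxl _ _)).
have h2 := hM _ (leq_maxr N M); move: h2; rewrite lincombB => h2.
set w := lincomb f e (c _) in h1 h2.
have -> : z - lincomb f e l = (z - w) + (w - lincomb f e l) by ring.
by have := avD b (z - w) (w - lincomb f e l); lra.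
Qed.

(** The equivalence of norms, by induction on the dimension: one more vector [x]
    stays at a positive distance from the span of the others because that span
    is closed, and this bounds the coordinate on [x]. *)
Lemma indep_coords_bounded n (e : 'I_n -> E) : lin_indep f e -> coords_bounded e.
Proof.
elim: n e => [|n IH] e ie; first by exists 0 => // c [].
pose e' := e \o widen_ord (leqnSn n); pose x := e ord_max.
have bd := IH e' (lin_indep_widen ie); have [C C0 hC] := bd.
have [d d0 hd] : exists2 d : R, 0 < d & forall c, d <= b (- x - lincomb f e' c).
  apply: contrapT => nd.
  have [c xc] : in_span f e' (- x).
    apply: span_closed => // d d0; apply: contrapT => /forallNP h; apply: nd; exists d => // c.
    by rewrite leNgt; apply/negP; exact: h.
  have /ie/(_ ord_max) : lincomb f e (rcons_family c 1) = 0.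
    by rewrite lincomb_recr rcons_family_widen rcons_family_max -xc rmorph1 mul1r addNr.
  by rewrite rcons_family_max => /eqP; rewrite oner_eq0.
have hmax c : a (c ord_max) <= d^-1 * b (lincomb f e c).
  have [->|c0] := eqVneq (c ord_max) 0.
    by rewrite av0 mulr_ge0 ?av_ge0// invr_ge0 ltW.
  set c' := fun i => (c ord_max)^-1 * c (widen_ord (leqnSn n) i).
  have -> : lincomb f e c = - (f (c ord_max) * (- x - lincomb f e' c')).
    rewrite lincomb_recr -/x -/e' /c' lincombZ mulrBr mulrA -rmorphM divff// rmorph1.
    by rewrite mul1r mulrN opprB opprK.
  by rewrite avN avM bf mulrCA ler_peMr ?av_ge0// ler_pdivlMl// mulr1.
exists (d^-1 + C * (1 + d^-1 * b x)) => [|c i].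
  by rewrite addr_ge0 ?mulr_ge0 ?addr_ge0 ?mulr_ge0 ?invr_ge0 ?av_ge0// ltW.
have d10 : 0 <= d^-1 by rewrite invr_ge0 ltW.
set B := b (lincomb f e c); have B0 : 0 <= B by exact: av_ge0.
have K0 : 0 <= C * (1 + d^-1 * b x) by rewrite mulr_ge0// addr_ge0// mulr_ge0// av_ge0.
have [j ->|->] := unliftP ord_max i; last first.
  by apply: le_trans (hmax c) _; rewrite -/B mulrDl lerDl mulr_ge0.
have -> : lift ord_max j = widen_ord (leqnSn n) j by apply: ord_inj; rewrite lift_max.
apply: le_trans (hC (c \o widen_ord (leqnSn n)) j) _.
apply: (@le_trans _ _ (C * (B + a (c ord_max) * b x))).
  rewrite ler_wpM2l//.
  have -> : lincomb f e' (c \o widen_ord (leqnSn n)) = lincomb f e c - f (c ord_max) * x.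
    by rewrite lincomb_recr addrK.
  by apply: le_trans (avB _ _ _) _; rewrite avM bf.
apply: (@le_trans _ _ (C * (B + d^-1 * B * b x))).
  by rewrite ler_wpM2l// lerD2l ler_wpM2r ?av_ge0// hmax.
have -> : C * (B + d^-1 * B * b x) = C * (1 + d^-1 * b x) * B by ring.
by rewrite mulrDl lerDr mulr_ge0.
Qed.

End CompleteSpan.

(** * Finite extensions given by a field morphism *)

Section FiniteExtensionAlias.
Variables (F E : fieldType) (f : {rmorphism F -> E}) (n : nat) (e : 'I_n -> E).
Hypotheses (ie : lin_indep f e) (se : forall x, in_span f e x).

(** A copy of [E] on which [F] acts through [f].  The two arguments
    tie the copy to [f] and to a basis, which its linear structure needs. *)
Definition ext_alias (_ : lin_indep f e) (_ : forall x, in_span f e x) : Type := E.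
Local Notation L := (ext_alias ie se).

HB.instance Definition _ := GRing.Field.on L.

Definition alias_scale (c : F) (x : L) : L := f c * (x : E).

Lemma alias_scalerA c d x : alias_scale c (alias_scale d x) = alias_scale (c * d) x.
Proof. by rewrite /alias_scale rmorphM mulrA. Qed.
Lemma alias_scale1r : left_id 1 alias_scale.
Proof. by move=> x; rewrite /alias_scale rmorph1 mul1r. Qed.
Lemma alias_scalerDr : right_distributive alias_scale +%R.
Proof. by move=> c x y; rewrite /alias_scale mulrDr. Qed.
Lemma alias_scalerDl x : {morph alias_scale^~ x : c d / c + d}.
Proof. by move=> c d; rewrite /alias_scale rmorphD mulrDl. Qed.

HB.instance Definition _ := GRing.Zmodule_isLmodule.Build F L
  alias_scalerA alias_scale1r alias_scalerDr alias_scalerDl.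

Lemma alias_scalerAl (c : F) (x y : L) : c *: (x * y) = (c *: x) * y.
Proof. exact: mulrA. Qed.
HB.instance Definition _ := GRing.Lmodule_isLalgebra.Build F L alias_scalerAl.
Lemma alias_scalerAr (c : F) (x y : L) : c *: (x * y) = x * (c *: y).
Proof. exact: mulrCA. Qed.
HB.instance Definition _ := GRing.Lalgebra_isAlgebra.Build F L alias_scalerAr.

Definition alias_coord (x : L) : 'rV[F]_n := \row_i projT1 (cid (se x)) i.

Lemma alias_coordE (x : L) : lincomb f e (alias_coord x 0) = x.
Proof.
rewrite [RHS](projT2 (cid (se x))); apply: eq_bigr => i _.
by rewrite mxE.
Qed.

Lemma lincomb_inj c d : lincomb f e c = lincomb f e d -> forall i, c i = d i.
Proof.
move=> cd i; apply/eqP; rewrite -subr_eq0; apply/eqP.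
have cd0 : lincomb f e (fun i => c i - d i) = 0 by rewrite lincombB cd subrr.
exact: (ie cd0).
Qed.

Lemma alias_vector : Vector.axiom n L.
Proof.
exists alias_coord.
  move=> c x y; apply/rowP => i; rewrite !mxE.
  move: i; apply: lincomb_inj.
  have -> : lincomb f e (projT1 (cid (se (c *: x + y)))) = f c * (x : E) + y.
    by rewrite -(projT2 (cid (se (c *: x + y)))).
  have -> : (fun i => c * projT1 (cid (se x)) i + projT1 (cid (se y)) i) =
     (fun i => c * projT1 (cid (se x)) i - -1 * projT1 (cid (se y)) i).
    by apply: funext => i; rewrite mulN1r opprK.
  rewrite lincombB !lincombZ -!(projT2 (cid (se _))).
  by rewrite rmorphN1 mulN1r opprK.
exists (fun v : 'rV_n => lincomb f e (v 0)); first exact: alias_coordE.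
move=> v; apply/rowP; apply: lincomb_inj; exact: alias_coordE.
Qed.

HB.instance Definition _ := Lmodule_hasFinDim.Build F L alias_vector.

Definition alias_fieldExt : fieldExtType F := L.
End FiniteExtensionAlias.

Section Finite.
Variables (F E : fieldType) (f : {rmorphism F -> E}).

Definition finite_ext := exists r (g : 'I_r -> E), forall x, in_span f g x.

(** Gives access to minimal polynomials and to the theory of separable elements
    for an extension that is only known through a morphism. *)
Lemma finite_ext_fieldExt : finite_ext ->
  exists (L : fieldExtType F) (phi : {rmorphism E -> L}),
    bijective phi /\ forall x, phi (f x) = x%:A.
Proof.
move=> [r [g hg]]; have [n [e [ie _ ge]]] := indep_subfamily f g.
have se x : in_span f e x by exact: ge.
exists (alias_fieldExt ie se).
pose phi : E -> alias_fieldExt ie se := id.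
have pz : zmod_morphism phi by [].
have pm : monoid_morphism phi by [].
pose phiA := GRing.isZmodMorphism.Build _ _ phi pz.
pose phiM := GRing.isMonoidMorphism.Build _ _ phi pm.
pose phiR : {rmorphism E -> alias_fieldExt ie se} := HB.pack phi phiA phiM.
exists phiR; split; first by exists id.
by move=> x; rewrite -[RHS]/(f x * 1) mulr1.
Qed.

Lemma absval_extend (R : realType) (a : absval R F) : finite_ext ->
  exists b : absval_ext f a, True.
Proof.
move=> /finite_ext_fieldExt[L [phi [_ fE]]].
have [b hb] := @absval_extension R F L a.
suff h x : av_restrict phi b (f x) = a x by exists (AbsvalExt h).
by rewrite /= fE hb.
Qed.
End Finite.

(** Otherwise the matrix of coordinates would have more rows than columns, and
    some combination of its rows would vanish. *)
Lemma indep_leq_span (F E : fieldType) (f : {rmorphism F -> E}) n m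
  (e : 'I_n -> E) (g : 'I_m -> E) :
  lin_indep f e -> (forall i, in_span f g (e i)) -> (n <= m)%N.
Proof.
move=> ie eg; rewrite leqNgt; apply/negP => mn.
pose M : 'M[F]_(n, m) := \matrix_(i, j) projT1 (cid (eg i)) j.
have eM i : e i = \sum_j f (M i j) * g j.
  by rewrite {1}(projT2 (cid (eg i))); apply: eq_bigr => j _; rewrite mxE.
have k0 : kermx M != 0.
  rewrite -mxrank_eq0 mxrank_ker subn_eq0 -ltnNge.
  exact: leq_ltn_trans (rank_leq_col M) mn.
have vM : nz_row (kermx M) *m M = 0 by apply/sub_kermxP; exact: nz_row_sub.
have : nz_row (kermx M) = 0.
  suff h : lincomb f e (nz_row (kermx M) 0) = 0 by apply/rowP => i; rewrite (ie _ h) mxE.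
  rewrite /lincomb; under eq_bigr => j _ do rewrite eM mulr_sumr.
  rewrite exchange_big /= big1// => j _.
  under eq_bigr => l _ do rewrite mulrA -rmorphM.
  rewrite -mulr_suml -rmorph_sum.
  by move/rowP/(_ j): vM; rewrite !mxE => ->; rewrite rmorph0 mul0r.
by move/eqP; rewrite nz_row_eq0 (negbTE k0).
Qed.

Lemma fieldExt_indep_le (F : fieldType) (L : fieldExtType F) n (e : 'I_n -> L) :
  lin_indep (in_alg L) e -> (n <= \dim {:L})%N.
Proof.
move=> ie; apply: (indep_leq_span ie (g := fun i => (vbasis {:L})`_i)) => i.
exists (fun l => coord (vbasis {:L}) l (e i)).
rewrite [LHS](coord_vbasis (memvf _)).
by apply: eq_bigr => l _; rewrite mulr_algl.
Qed.

(** A maximal independent family spans. *)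
Lemma bounded_indep_finite (F E : fieldType) (f : {rmorphism F -> E}) N :
  (forall n (e : 'I_n -> E), lin_indep f e -> (n <= N)%N) -> finite_ext f.
Proof.
move=> hN.
pose P n := `[< exists e : 'I_n -> E, lin_indep f e >].
have P0 : exists n, P n by exists 0%N; apply/asboolP; exists (fun=> 0) => c _ [].
have PN n : P n -> (n <= N)%N by move=> /asboolP[e /hN].
case: (ex_maxnP P0 PN) => n /asboolP[e ie] nmax.
exists n, e => x; apply: contrapT => nx.
have [m [g [ig _ sg]]] := indep_subfamily f (rcons_family e x).
have gx : in_span f g x.
  apply: sg; exists (rcons_family (fun=> 0) 1).
  rewrite lincomb_recr !rcons_family_widen !rcons_family_max rmorph1 mul1r.
  by rewrite /lincomb big1 ?add0r// => i _; rewrite rmorph0 mul0r.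
have nm : (m <= n)%N by apply: nmax; apply/asboolP; exists g.
have ge i : in_span f g (e i).
  apply: sg; exists (rcons_family (fun j => (j == i)%:R) 0).
  rewrite lincomb_recr !rcons_family_widen !rcons_family_max rmorph0 mul0r addr0.
  rewrite /lincomb (bigD1 i)//= eqxx rmorph1 mul1r big1 ?addr0// => j /negbTE ->.
  by rewrite rmorph0 mul0r.
have : (n < m)%N -> False by rewrite ltnNge nm.
apply; apply: (@indep_leq_span _ _ f _ _ (rcons_family e x) g) => [|i].
  exact: lin_indep_rcons.
have [j ->|->] := unliftP ord_max i; last by rewrite rcons_family_max.
by rewrite /rcons_family liftK; exact: ge.
Qed.

Lemma is_sepdeg_unique (F E : fieldType) (f : {rmorphism F -> E}) n m :
  is_sepdeg f n -> is_sepdeg f m -> n = m.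
Proof.
move=> [b [sb ib gb]] [c [sc ic gc]]; apply/eqP; rewrite eqn_leq.
apply/andP; split.
  by apply: (@indep_leq_span _ _ f _ _ b c ib) => i; exact: gc (sb i).
by apply: (@indep_leq_span _ _ f _ _ c b ic) => i; exact: gb (sc i).
Qed.

Lemma sepdegE (F E : fieldType) (f : {rmorphism F -> E}) n :
  is_sepdeg f n -> sepdeg f = n.
Proof. by move=> hn; apply: xget_unique => // m /is_sepdeg_unique; apply. Qed.

(** * Separable degree *)

Section SeparableGenerator.
Variables (F E : fieldType) (f : {rmorphism F -> E}).

Definition sep_minpoly (p : {poly F}) (x : E) :=
  [/\ p \is monic, irreducible_poly p, root (map_poly f p) x & separable_poly p].

(** [E] is purely inseparable over [F(t)]; in characteristic [0] the exponent is
    [1] and [t] generates [E]. *)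
Definition insep_over (t : E) := forall x : E, exists (q : nat) (g : {poly F}),
  [pchar F].-nat q /\ x ^+ q = (map_poly f g).[t].

(** [F(t)] is the separable closure of [F] in [E] and [p] is the minimal
    polynomial of [t]. *)
Definition sep_generator p (t : E) := sep_minpoly p t /\ insep_over t.
End SeparableGenerator.

Section IrreducibleRoots.
Variables (F E : fieldType) (f : {rmorphism F -> E}) (p : {poly F}) (t : E).
Hypotheses (ip : irreducible_poly p) (pt : root (map_poly f p) t).

Lemma irreducible_dvd_root (g : {poly F}) : (map_poly f g).[t] = 0 -> p %| g.
Proof.
move=> gt; apply: contraT; rewrite -irreducible_poly_coprime//.
by rewrite -(coprimep_map f) => /coprimep_root/(_ pt); rewrite gt eqxx.
Qed.

Lemma powers_indep : lin_indep f (fun l : 'I_(size p).-1 => t ^+ l).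
Proof.
move=> c c0 l; have p0 : (0 < size p)%N by rewrite ltnW// ip.1.
pose g := \poly_(m < (size p).-1) (if insub m is Some r then c r else 0).
have gi (m : 'I_(size p).-1) : g`_m = c m by rewrite coef_poly ltn_ord valK.
have g0 : (map_poly f g).[t] = 0.
  rewrite (@horner_coef_wide _ (size p).-1) ?size_map_poly ?size_poly//.
  by rewrite -[RHS]c0; apply: eq_bigr => m _; rewrite coef_map gi.
suff /eqP g00 : g == 0 by rewrite -gi g00 coef0.
apply: contraT => gn0; have /(dvdp_leq gn0) := irreducible_dvd_root g0.
rewrite leqNgt; have : (size g < size p)%N; last by move=> ->.
by rewrite (leq_ltn_trans (size_poly _ _))// prednK.
Qed.
End IrreducibleRoots.

Section FieldExtSepdeg.
Variables (F : fieldType) (L : fieldExtType F).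
Local Notation iota := (in_alg L : {rmorphism F -> L}).

Lemma minPoly_descent (x : L) : exists p : {poly F},
  [/\ p \is monic, irreducible_poly p & minPoly 1 x = map_poly iota p].
Proof.
have /polyOver1P[p Dp] := minPolyOver 1%AS x.
have pm : p \is monic by rewrite -(map_monic iota) -Dp monic_minPoly.
exists p; split=> //; split.
  by rewrite -(size_map_poly iota) -Dp size_minPoly ltnS adjoin_degreeE divn_gt0 ?adim_gt0// dimvS// subv_adjoin.
move=> q q1; rewrite -(dvdp_map iota) -Dp => qp.
have /orP[] := minPoly_irr (alg_polyOver 1%AS q) qp.
  by rewrite Dp eqp_map.
by rewrite -(rmorph1 (map_poly iota)) eqp_map -size_poly_eq1 (negbTE q1).
Qed.

Lemma sep_minpoly_minPoly p x : sep_minpoly iota p x -> minPoly 1 x = map_poly iota p.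
Proof.
move=> [pm [p1 irr] px _]; have [q [qm [q1 _] Dq]] := minPoly_descent x.
have : minPoly 1 x %| map_poly iota p by apply: minPoly_dvdp => //; exact: alg_polyOver.
rewrite Dq dvdp_map => /irr; rewrite gtn_eqF// => /(_ isT) pq.
congr map_poly; apply/eqP; rewrite -eqp_monic//.
Qed.

Lemma separable_overP (x : L) : separable_over iota x <-> separable_element 1 x.
Proof.
split=> [[p [pm irr px sp]]|sx].
  have sx : sep_minpoly iota p x by split.
  by rewrite /separable_element (sep_minpoly_minPoly sx) separable_map.
have [p [pm irr Dp]] := minPoly_descent x; exists p; split=> //.
  by rewrite -Dp root_minPoly.
by rewrite -(separable_map iota) -Dp.
Qed.

Lemma fieldExt_sep_generator : exists p t, @sep_generator F L iota p t.
Proof.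
have [t [_ st] /purely_inseparableP it] := separable_inseparable_decomposition {:L} 1%AS.
have [p [pm irr Dp]] := minPoly_descent t; exists p, t; split.
  split=> //; first by rewrite -Dp root_minPoly.
  by rewrite -(separable_map iota) -Dp.
move=> x; have /purely_inseparable_elementP_pchar[q qn] := it x (memvf x).
move=> /Fadjoin1_polyP[g xq]; exists q, g; split=> //.
by rewrite -(eq_pnat _ (fmorph_pchar iota)).
Qed.

(** The separable elements form [F(t)], with basis the powers of [t]: an element
    both separable and purely inseparable over [F(t)] lies in it. *)
Lemma fieldExt_sepdeg p t : @sep_generator F L iota p t -> is_sepdeg iota (size p).-1.
Proof.
move=> [sp it]; have Dp := sep_minpoly_minPoly sp.
have [pm irr pt psep] := sp.
have st : separable_element 1 t by apply/separable_overP; exists p.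
have szp : (size p).-1 = adjoin_degree 1 t.
  by rewrite -(size_map_poly iota) -Dp size_minPoly.
exists (fun i => t ^+ i); split.
- move=> i; apply/separable_overP; move/adjoin_separableP: st; apply.
  by rewrite rpredX// memv_adjoin.
- exact: powers_indep irr pt.
- move=> x /separable_overP sx.
  have : x \in <<1; t>>%VS.
    rewrite -separable_inseparable_element.
    rewrite (separable_elementS (subv_adjoin 1%AS t) sx) /=.
    apply/purely_inseparable_elementP_pchar; have [q [g [qn xq]]] := it x.
    exists q; first by rewrite (eq_pnat _ (fmorph_pchar iota)).
    by rewrite xq mempx_Fadjoin// alg_polyOver.
  move=> xt; have /polyOver1P[g Dg] := Fadjoin_polyOver 1%VS t x.
  exists (fun i => g`_i); rewrite -[LHS](Fadjoin_poly_eq xt).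
  rewrite (@horner_coef_wide _ (size p).-1); last by rewrite szp size_Fadjoin_poly.
  by apply: eq_bigr => i _; rewrite Dg coef_map.
Qed.
End FieldExtSepdeg.

Section FiniteSepdeg.
Variables (F E : fieldType) (f : {rmorphism F -> E}).
Hypothesis fin : finite_ext f.

Section Transport.
Variables (L : fieldExtType F) (phi : {rmorphism E -> L}).
Hypothesis phif : forall x, phi (f x) = x%:A.

Lemma map_poly_transport (p : {poly F}) :
  map_poly phi (map_poly f p) = map_poly (in_alg L) p.
Proof. by rewrite -map_poly_comp; apply: eq_map_poly => x; exact: phif. Qed.

Lemma root_transport (p : {poly F}) x :
  root (map_poly (in_alg L) p) (phi x) = root (map_poly f p) x.
Proof. by rewrite -map_poly_transport fmorph_root. Qed.

Lemma horner_transport (p : {poly F}) x :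
  (map_poly (in_alg L) p).[phi x] = phi (map_poly f p).[x].
Proof. by rewrite -map_poly_transport horner_map. Qed.

Lemma sep_minpoly_transport p x :
  sep_minpoly (in_alg L) p (phi x) <-> sep_minpoly f p x.
Proof. by rewrite /sep_minpoly root_transport. Qed.
End Transport.

Lemma sep_generator_exists : exists p t, sep_generator f p t.
Proof.
have [L [phi [[psi phiK psiK] phif]]] := finite_ext_fieldExt fin.
have [p [t [sp it]]] := fieldExt_sep_generator L.
exists p, (psi t); split; first by apply/(sep_minpoly_transport phif); rewrite psiK.
move=> x; have [q [g [qn xq]]] := it (phi x); exists q, g; split=> //.
by apply: (fmorph_inj phi); rewrite rmorphXn /= xq -(horner_transport phif) psiK.
Qed.

(** Separable degrees are always computed with this lemma: globally in [L / k],
    and locally for the image of the same [t] in a completion. *)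
Lemma sep_generator_sepdeg p t : sep_generator f p t -> sepdeg f = (size p).-1.
Proof.
move=> [sp it]; apply: sepdegE.
have [L [phi [[psi phiK psiK] phif]]] := finite_ext_fieldExt fin.
have [|b [bs bi bg]] := @fieldExt_sepdeg _ L p (phi t).
  split; first exact/(sep_minpoly_transport phif).
  move=> x; have [q [g [qn xq]]] := it (psi x); exists q, g; split=> //.
  by rewrite (horner_transport phif) -xq rmorphXn /= psiK.
have spE x : separable_over f x <-> separable_over (in_alg L) (phi x).
  split=> -[h hh]; exists h; move: hh; last by move/(sep_minpoly_transport phif).
  by move/(sep_minpoly_transport phif).
exists (psi \o b); split.
- by move=> i; apply/spE; rewrite /= psiK.
- move=> c c0; apply: bi; have := congr1 phi c0; rewrite rmorph0 rmorph_sum => phi0; rewrite -[RHS]phi0.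
  by apply: eq_bigr => i _; rewrite rmorphM phif /= psiK.
- move=> x /spE/bg[c xc]; exists c; apply: (fmorph_inj phi); rewrite xc rmorph_sum.
  by apply: eq_bigr => i _; rewrite rmorphM phif /= psiK.
Qed.
End FiniteSepdeg.

(** * Factors of separable polynomials *)

Section Factorization.
Variable F : fieldType.
Implicit Types p q : {poly F}.

Definition prime_poly p := p \is monic /\ irreducible_poly p.

Lemma prime_poly_coprime p q : prime_poly p -> prime_poly q -> p != q -> coprimep p q.
Proof.
move=> [pm ip] [qm [_ iq]] pq; rewrite irreducible_poly_coprime//.
apply: contra pq => /iq; rewrite gtn_eqF ?ip.1// => /(_ isT).
by rewrite eqp_monic.
Qed.

(** Either [p] is irreducible, or a smaller nonconstant divisor takes over. *)
Lemma prime_divisor p : (1 < size p)%N -> exists2 q, prime_poly q & q %| p.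
Proof.
have [n] := ubnP (size p); elim: n p => // n IH p; rewrite ltnS => pn p1.
have p0 : p != 0 by rewrite -size_poly_gt0 ltnW.
have [ip|/not_andP[//|/existsNP[q /not_implyP[q1 /not_implyP[qp /negP nqp]]]]] := pselect (irreducible_poly p).
  have lp0 : lead_coef p != 0 by rewrite lead_coef_eq0.
  have e : (lead_coef p)^-1 *: p %= p by rewrite eqp_scale// invr_eq0.
  exists ((lead_coef p)^-1 *: p); last by rewrite (eqp_dvdl _ e).
  split; first by rewrite monicE lead_coefZ mulVf.
  split; first by rewrite (eqp_size e).
  move=> q q1; rewrite (eqp_dvdr _ e) => /(ip.2 _ q1) qp.
  by rewrite (eqp_trans qp)// eqp_sym.
have q0 : q != 0 by apply: contraNneq p0 => q0; rewrite -dvd0p -q0.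
have qs : (1 < size q)%N by rewrite ltn_neqAle eq_sym q1 size_poly_gt0.
have qn : (size q < n)%N.
  apply: leq_trans pn; rewrite ltn_neqAle dvdp_leq// andbT.
  by rewrite (dvdp_size_eqp qp).
have [r pr rq] := IH q qn qs; exists r => //; exact: dvdp_trans rq qp.
Qed.

(** Separability makes a prime divisor coprime to its cofactor, hence the
    factors distinct. *)
Lemma separable_factorization p : p \is monic -> separable_poly p ->
  exists s : seq {poly F}, [/\ uniq s, forall q, q \in s -> prime_poly q,
    p = \prod_(q <- s) q & (\sum_(q <- s) (size q).-1 = (size p).-1)%N].
Proof.
have [n] := ubnP (size p); elim: n p => // n IH p; rewrite ltnS => pn pm sp.
have [p1|p1] := leqP (size p) 1.
  have -> : p = 1.
    apply/eqP; rewrite -eqp_monic ?monic1// -size_poly_eq1 eqn_leq p1.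
    by rewrite size_poly_gt0 monic_neq0.
  by exists [::]; rewrite !big_nil size_poly1; split.
have [q prq /dvdpP[r Dp]] := prime_divisor p1; have [qm iq] := prq.
have rm : r \is monic by rewrite -(monicMr _ qm) -Dp.
have /and3P[sr sq crq] : [&& separable_poly r, separable_poly q & coprimep r q].
  by rewrite -separable_mul -Dp.
have szp : size p = (size r + size q).-1.
  by rewrite Dp size_proper_mul// (monicP qm) (monicP rm) mulr1 oner_eq0.
have rn : (size r < n)%N.
  apply: leq_trans pn; rewrite szp; have := iq.1.
  by case: (size q) => [//|[//|m _]]; rewrite !addnS /= ltnS leq_addr.
have [s [us ps Dr Ss]] := IH r rn rm sr; exists (q :: s); split.
- rewrite /= us andbT; apply/negP => qs; have qr : q %| r.
    by rewrite Dr (big_rem q)//= dvdp_mulr.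
  move: crq; rewrite coprimep_sym irreducible_poly_coprime// qr //.
- by move=> h; rewrite inE => /orP[/eqP -> //|/ps].
- by rewrite big_cons Dp -Dr mulrC.
- rewrite big_cons Ss szp; have := iq.1; have : (0 < size r)%N by rewrite size_poly_gt0 monic_neq0.
  by case: (size r) (size q) => [//|m] [//|m'] _ _; rewrite /= addnS /= addnC.
Qed.
End Factorization.

Section EvaluationBounds.
Variables (R : realType) (F E : fieldType) (f : {rmorphism F -> E}).
Variables (a : absval R F) (b : absval R E).
Hypothesis bf : forall x, b (f x) = a x.

Lemma av_horner_le n (h : {poly F}) t (d : R) : (size h <= n)%N ->
  (forall i, a h`_i <= d) ->
  b (map_poly f h).[t] <= d * \sum_(i < n) b t ^+ i.
Proof.
move=> hn hd; rewrite (@horner_coef_wide _ n) ?size_map_poly//.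
apply: le_trans (av_sum _ _ _) _; rewrite mulr_sumr; apply: ler_sum => i _.
by rewrite coef_map avM bf avX ler_wpM2r// exprn_ge0// av_ge0.
Qed.
End EvaluationBounds.

(** Polynomials with the same value at [y] differ by a multiple of [p], so they
    have the same value at [t]. *)
Lemma simple_ext_morphism (k : fieldType) (M : fieldExtType k) (y : M) (p : {poly k})
  (T : fieldType) (h : {rmorphism k -> T}) (t : T) :
  <<1; y>>%VS = {:M}%VS -> irreducible_poly p ->
  root (map_poly (in_alg M) p) y -> root (map_poly h p) t ->
  exists psi : {rmorphism M -> T}, forall g : {poly k},
    psi (map_poly (in_alg M) g).[y] = (map_poly h g).[t].
Proof.
move=> yM ip py pt.
have rep (x : M) : exists g : {poly k}, x = (map_poly (in_alg M) g).[y].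
  by apply/Fadjoin1_polyP; rewrite yM memvf.
pose G x := projT1 (cid (rep x)); have GE x : (map_poly (in_alg M) (G x)).[y] = x.
  by rewrite -(projT2 (cid (rep x))).
have wd g g' : (map_poly (in_alg M) g).[y] = (map_poly (in_alg M) g').[y] ->
    (map_poly h g).[t] = (map_poly h g').[t].
  move=> e; apply/eqP; rewrite -subr_eq0 -hornerN -hornerD -rmorphN -rmorphD.
  have : p %| g - g'.
    by apply: (irreducible_dvd_root ip py); rewrite rmorphB /= hornerD hornerN e subrr.
  by move=> /dvdpP[r ->]; rewrite rmorphM hornerM (rootP pt) mulr0.
pose psi x := (map_poly h (G x)).[t].
have pz : zmod_morphism psi.
  move=> x x'; rewrite /psi -hornerN -hornerD -rmorphN -rmorphD.
  by apply: wd; rewrite GE rmorphB /= hornerD hornerN !GE.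
have pm : monoid_morphism psi.
  split.
    rewrite -[RHS](hornerC 1 t) polyC1 -[in RHS](rmorph1 (map_poly h)).
    by apply: wd; rewrite GE rmorph1 hornerC.
  by move=> x x'; rewrite /psi -hornerM -rmorphM; apply: wd; rewrite GE rmorphM /= hornerM !GE.
pose phiA := GRing.isZmodMorphism.Build _ _ psi pz.
pose phiM := GRing.isMonoidMorphism.Build _ _ psi pm.
pose psiR : {rmorphism M -> T} := HB.pack psi phiA phiM.
by exists psiR => g; apply: wd; rewrite GE.
Qed.

(** * Extensions of an absolute value and local degrees *)

Section Local.
Variables (R : realType) (k L : fieldType) (iota : {rmorphism k -> L}).
Hypothesis fin : finite_ext iota.
Variable a : absval R k.
Local Notation kh := (completion a).
Local Notation ah := (compl_av a).
Local Notation j := (to_compl a : {rmorphism k -> completion a}).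

(** The span of [L] over the completion of [k] is closed, being of finite
    dimension, and dense, since it contains [L]. *)
Lemma completion_finite_span r (g : 'I_r -> L) (i : absval_ext iota a) :
  (forall x, in_span iota g x) ->
  exists n (e : 'I_n -> L), forall z, in_span (completion_map i) (to_compl i \o e) z.
Proof.
move=> hg; pose cm := completion_map i.
have [n [e [ie eg ge]]] := indep_subfamily cm (to_compl i \o g).
pose s l := projT1 (cid (eg l)).
exists n, (g \o s).
have -> : to_compl i \o (g \o s) = e.
  by apply: funext => l; rewrite [RHS](projT2 (cid (eg l))).
have bd := indep_coords_bounded (completion_mapE i) (@completion_complete _ _ a) ie.
move=> z; apply: (span_closed (completion_mapE i) (@completion_complete _ _ a) bd) => d d0.
have [x hx] := compl_dense z d0.
have [c xc] := hg x.
have [|c' hc'] := ge (to_compl i x); last by exists c'; rewrite -hc'.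
exists (fun l => to_compl a (c l)); rewrite xc rmorph_sum; apply: eq_bigr => l _.
by rewrite rmorphM /= completion_map_to.
Qed.

Lemma completion_finite (i : absval_ext iota a) : finite_ext (completion_map i).
Proof.
have [r [g /(completion_finite_span i)[n [e he]]]] := fin.
by exists n, (to_compl i \o e).
Qed.

Variables (P : {poly k}) (t : L).
Hypothesis gen : sep_generator iota P t.

Lemma pchar_completion : [pchar kh] =i [pchar k].
Proof. exact: (fmorph_pchar j). Qed.

Lemma map_poly_to_compl (i : absval_ext iota a) (g : {poly k}) :
  map_poly (completion_map i) (map_poly j g) = map_poly (to_compl i) (map_poly iota g).
Proof.
by rewrite -!map_poly_comp; apply: eq_map_poly => x; exact: completion_map_to.
Qed.

Lemma horner_to_compl (i : absval_ext iota a) (g : {poly k}) :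
  (map_poly (completion_map i) (map_poly j g)).[to_compl i t] =
  to_compl i (map_poly iota g).[t].
Proof. by rewrite map_poly_to_compl horner_map. Qed.

(** The elements with a [q]-th power in [kh(t)], for some power [q] of the
    characteristic exponent, are closed under linear combinations over [kh], and
    those of [L] are among them. *)
Lemma completion_insep (i : absval_ext iota a) :
  insep_over (completion_map i) (to_compl i t).
Proof.
have [r [g /(completion_finite_span i)[n [e he]]]] := fin.
pose cm := completion_map i.
pose ok (x : completion i) := exists (q : nat) (g : {poly kh}),
  [pchar kh].-nat q /\ x ^+ q = (map_poly cm g).[to_compl i t].
have okD x y : ok x -> ok y -> ok (x + y).
  move=> [q [h [qn xq]]] [q' [h' [qn' xq']]]; exists (q * q')%N, (h ^+ q' + h' ^+ q).
  rewrite pnatM qn qn'; split=> //; rewrite exprDn_pchar; last first.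
    by rewrite (eq_pnat _ (fmorph_pchar cm)) pnatM qn qn'.
  by rewrite exprM xq mulnC exprM xq' rmorphD !rmorphXn /= hornerD !horner_exp.
have okZ c l : ok (cm c * to_compl i (e l)).
  have [q [h [qn eq]]] := gen.2 (e l); exists q, (c ^+ q *: map_poly j h).
  rewrite (eq_pnat _ pchar_completion) qn; split=> //.
  rewrite exprMn -rmorphXn /= -(rmorphXn (to_compl i)) /= eq -horner_to_compl.
  by rewrite map_polyZ hornerZ.
have ok0 : ok 0 by exists 1%N, 0; rewrite rmorph0 horner0 expr1.
move=> z; have [c ->] := he z.
by apply: (big_ind ok) => // l _; exact: okZ.
Qed.

(** The local factors of [P] index the extensions: [i] corresponds to the
    factor that vanishes at the image of [t] in the completion for [i]. *)
Definition local_factor (i : absval_ext iota a) (q : {poly kh}) :=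
  root (map_poly (completion_map i) q) (to_compl i t).

Lemma local_root (i : absval_ext iota a) : local_factor i (map_poly j P).
Proof.
by have [[_ _ Pt _] _] := gen; rewrite /local_factor map_poly_to_compl fmorph_root.
Qed.

Lemma local_factor_unique (i : absval_ext iota a) p q : prime_poly p -> prime_poly q ->
  local_factor i p -> local_factor i q -> p = q.
Proof.
move=> pp pq rp rq; apply/eqP; apply: contraT => /(prime_poly_coprime pp pq).
by rewrite -(coprimep_map (completion_map i)) => /coprimep_root/(_ rp); rewrite (rootP rq) eqxx.
Qed.

Lemma local_sepdeg (i : absval_ext iota a) q : prime_poly q -> separable_poly q ->
  local_factor i q -> sepdeg (completion_map i) = (size q).-1.
Proof.
move=> [qm iq] sq rq; apply: (@sep_generator_sepdeg _ _ _ (completion_finite i) q (to_compl i t)).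
by split; [split | exact: completion_insep].
Qed.

(** Through evaluation at the images of [t], both extensions become norms on
    the space of polynomials modulo [q], and norms there are equivalent.  The
    constant disappears on taking powers, and a power of [x] lies in [k(t)]. *)
Lemma local_factor_le (i i' : absval_ext iota a) q : prime_poly q ->
  local_factor i q -> local_factor i' q -> forall x, i' x <= i x.
Proof.
move=> pq rq rq'; have [qm iq] := pq; set n := (size q).-1.
have [C C0 hC] := indep_coords_bounded (completion_mapE i)
  (@completion_complete _ _ a) (powers_indep iq rq).
pose B (i : absval_ext iota a) h := compl_av i (map_poly (completion_map i) h).[to_compl i t].
pose D := C * \sum_(l < n) compl_av i' (to_compl i' t) ^+ l.
have szn (h : {poly kh}) : (size (h %% q)%R <= n)%N.
  rewrite -ltnS prednK ?size_poly_gt0 ?monic_neq0//.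
  by rewrite ltn_modp monic_neq0.
have Bmod (i0 : absval_ext iota a) h : local_factor i0 q -> B i0 h = B i0 (h %% q).
  move=> r0; rewrite /B {1}(divp_eq h q) rmorphD rmorphM /= hornerD hornerM.
  by rewrite (rootP r0) mulr0 add0r.
have BD h : B i' h <= D * B i h.
  rewrite (Bmod i') // (Bmod i) //; set g := h %% q.
  rewrite /D mulrAC; apply: (@av_horner_le _ _ _ _ _ _ (completion_mapE i') n).
    exact: szn.
  move=> l; have [ln|nl] := ltnP l n; last first.
    by rewrite nth_default ?av0 ?mulr_ge0 ?av_ge0// (leq_trans (szn h)).
  have := hC (fun m => g`_m) (Ordinal ln); rewrite /= => /le_trans; apply.
  rewrite ler_wpM2l// /B (@horner_coef_wide _ n) ?size_map_poly ?szn//.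
  rewrite /lincomb le_eqVlt; apply/orP; left; apply/eqP; congr (compl_av i _).
  by apply: eq_bigr => m _; rewrite coef_map.
have Bi (i0 : absval_ext iota a) (g : {poly k}) : B i0 (map_poly j g) = i0 (map_poly iota g).[t].
  by rewrite /B horner_to_compl to_complE.
move=> x; have [e [g [en xe]]] := gen.2 x.
have e0 : (0 < e)%N by case/andP: en.
rewrite -(ler_pXn2r e0) ?nnegrE ?av_ge0// -!avX.
apply: (@le_of_exp_bound _ D); first exact: av_ge0.
move=> m; rewrite -!avX xe -horner_exp -rmorphXn /= -!Bi.
exact: BD.
Qed.

Lemma local_factor_inj (i i' : absval_ext iota a) q : prime_poly q ->
  local_factor i q -> local_factor i' q -> i = i'.
Proof.
move=> pq rq rq'.
apply: absval_ext_eq => x.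
by apply/eqP; rewrite eq_le !(@local_factor_le _ _ q).
Qed.

(** The absolute value extends from [kh] to the field [T] generated by a root
    [z] of [q], is restricted to [M = k(t)] along [t |-> z], and extends from [M]
    to [L].  To see that [q] vanishes at [t] for the result [i], approximate [q]
    by polynomials over [k], whose values at [t] and at [z] have the same size. *)
Lemma local_factor_exists q : prime_poly q -> q %| map_poly j P ->
  exists i, local_factor i q.
Proof.
move=> [qm iq] /dvdpP[r Dr]; have [[Pm iP Pt Psep] _] := gen.
have [M _ [y Py yM]] := irredp_FAdjoin iP.
have [T _ [z qz _]] := irredp_FAdjoin iq.
have [b hb] := absval_extension T ah.
pose h : {rmorphism k -> T} := in_alg T \o j.
have Pz : root (map_poly h P) z.
  have -> : map_poly h P = map_poly (in_alg T) (map_poly j P) by rewrite -map_poly_comp.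
  by rewrite Dr rmorphM /= rootM qz orbT.
have [psiT hT] := simple_ext_morphism yM iP Py Pz.
have [psiL hL] := simple_ext_morphism yM iP Py Pt.
have cst (U : fieldType) (u : {rmorphism k -> U}) (c : k) w : (map_poly u c%:P).[w] = u c.
  by rewrite map_polyC hornerC.
have psiLc c : psiL c%:A = iota c.
  by have := hL c%:P; rewrite !cst.
have finL : finite_ext psiL.
  have [n [g hg]] := fin; exists n, g => x; have [c ->] := hg x.
  by exists (fun l => (c l)%:A); apply: eq_bigr => l _; rewrite psiLc.
have [i0 _] := absval_extend (av_restrict psiT b) finL.
have i0T (g : {poly k}) : i0 (map_poly iota g).[t] = b (map_poly h g).[z].
  by rewrite -hL ext_avE /= hT.
have i0k c : i0 (iota c) = a c.
  have := i0T c%:P; rewrite !cst => ->.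
  by rewrite /= hb to_complE.
pose i : absval_ext iota a := AbsvalExt i0k.
exists i; apply/rootP/(av_eq0 (compl_av i)); apply/eqP; rewrite eq_le av_ge0 andbT.
set w := to_compl i t; set n := size q.
(* Coefficients within [d / D] change the values at [w] and at [z] by at most [d]
   altogether. *)
pose D := \sum_(l < n) compl_av i w ^+ l + \sum_(l < n) b z ^+ l + 1.
have S1 : 0 <= \sum_(l < n) compl_av i w ^+ l.
  by apply: sumr_ge0 => l _; rewrite exprn_ge0// av_ge0.
have S2 : 0 <= \sum_(l < n) b z ^+ l.
  by apply: sumr_ge0 => l _; rewrite exprn_ge0// av_ge0.
have D0 : 0 < D by rewrite /D; lra.
apply/ler_addgt0Pl => d d0; rewrite addr0.
have dD : 0 < d / D by rewrite divr_gt0.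
pose c l := projT1 (cid (compl_dense (q`_l) dD)).
have hc l : ah (q`_l - j (c l)) < d / D by exact: (projT2 (cid (compl_dense (q`_l) dD))).
pose g := \poly_(l < n) c l.
pose u := q - map_poly j g.
have un : (size u <= n)%N.
  rewrite (leq_trans (size_polyD _ _))// size_polyN geq_max leqnn /=.
  by rewrite size_map_poly size_poly.
have ud l : ah u`_l <= d / D.
  have [ln|nl] := ltnP l n; last by rewrite nth_default ?av0 ?ltW// (leq_trans un).
  by rewrite coefB coef_map coef_poly ln ltW.
have Dq : q = u + map_poly j g by rewrite subrK.
have h1 : compl_av i (map_poly (completion_map i) u).[w] <= d / D * \sum_(l < n) compl_av i w ^+ l.
  exact: (av_horner_le (completion_mapE i)).
have h2 : b (map_poly (in_alg T) u).[z] <= d / D * \sum_(l < n) b z ^+ l.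
  exact: (@av_horner_le _ _ _ (in_alg T) ah b hb).
have gz : (map_poly h g).[z] = - (map_poly (in_alg T) u).[z].
  apply/eqP; rewrite -addr_eq0 addrC; apply/eqP.
  have -> : map_poly h g = map_poly (in_alg T) (map_poly j g) by rewrite -map_poly_comp.
  by rewrite -hornerD -rmorphD -Dq; exact/rootP.
have h3 : compl_av i (map_poly (completion_map i) (map_poly j g)).[w] = b (map_poly (in_alg T) u).[z].
  rewrite horner_to_compl to_complE -[LHS]/(i0 (map_poly iota g).[t]) i0T gz.
  exact: avN.
rewrite {1}Dq rmorphD hornerD; apply: le_trans (avD _ _ _) _; rewrite h3.
apply: le_trans (lerD h1 h2) _; rewrite -mulrDr mulrAC ler_pdivrMr// ler_pM2l// /D.
by lra.
Qed.
End Local.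

(** The extensions are in bijection with the factors of [P] over the completion,
    whose degrees add up to that of [P]. *)
Theorem sum_local_sepdeg (R : realType) (k L : fieldType) (iota : {rmorphism k -> L})
  (a : absval R k) : finite_ext iota ->
  \sum_(i \in [set: absval_ext iota a]%classic)
     ((sepdeg (completion_map i))%:R / (sepdeg iota)%:R : rat) = 1.
Proof.
move=> fin; have [P [t gen]] := sep_generator_exists fin.
have [[Pm iP Pt Psep] it] := gen.
pose j := (to_compl a : {rmorphism k -> completion a}).
have Pjm : map_poly j P \is monic by rewrite map_monic.
have Pjs : separable_poly (map_poly j P) by rewrite separable_map.
have [s [us ps DP SP]] := separable_factorization Pjm Pjs.
have sdiv q : q \in s -> q %| map_poly j P.
  by move=> qs; rewrite DP (big_rem q)//= dvdp_mulr.
have ssep q : q \in s -> separable_poly q.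
  by move=> /sdiv/dvdpP[r e]; move: Pjs; rewrite e separable_mul => /and3P[].
have ex (i : absval_ext iota a) : exists q, q \in s /\ local_factor t i q.
  apply: contrapT => /forallNP nq; have := local_root gen i.
  rewrite /local_factor DP rmorph_prod /= => r0.
  have := root_bigmul (to_compl i t) [seq map_poly (completion_map i) q | q <- s].
  rewrite big_map r0 => /esym/negbT/negP; apply; apply/allP => _ /mapP[q qs ->].
  by apply/negP => rq; apply: (nq q).
pose phi i := projT1 (cid (ex i)).
have phis i : phi i \in s by case: (projT2 (cid (ex i))).
have phir i : local_factor t i (phi i) by case: (projT2 (cid (ex i))).
pose G (q : {poly completion a}) : rat := (size q).-1%:R / (sepdeg iota)%:R.
have bij : set_bij [set: absval_ext iota a]%classic [set` s]%classic phi.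
  split.
  - by move=> i _; exact: phis.
  - move=> i i' _ _ e; apply: (local_factor_inj gen (ps _ (phis i)) (phir i)).
    by rewrite e; exact: phir.
  - move=> q /= qs; have [i ri] := local_factor_exists fin gen (ps _ qs) (sdiv _ qs).
    by exists i => //; apply: (local_factor_unique (ps _ (phis i)) (ps _ qs) (phir i) ri).
have FG (i : absval_ext iota a) : (sepdeg (completion_map i))%:R / (sepdeg iota)%:R = G (phi i) :> rat.
  by rewrite /G (local_sepdeg fin gen (ps _ (phis i)) (ssep _ (phis i)) (phir i)).
under eq_fsbigr do rewrite FG.
rewrite -(reindex_fsbig phi _ _ G bij) -fsbig_seq// /G -mulr_suml -natr_sum SP.
rewrite size_map_poly (sep_generator_sepdeg fin gen) divff// pnatr_eq0 -lt0n.
by have := iP.1; case: (size P) => [|[]].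
Qed.

(** * Pseudo-absolute values *)

Section PavTheory.
Variables (R : realType) (F : fieldType) (w : pseudo_absval R F).
Local Open Scope ereal_scope.

(** Otherwise multiplicativity would apply to [x] and its inverse and make the
    value of [1] infinite. *)
Lemma pav_inv_infty x : w x = +oo -> w (x^-1)%R = 0.
Proof.
move=> wx; have x0 : x != 0%R by apply/eqP => x0; move: wx; rewrite x0 pav0.
have [//|wy] := eqVneq (w (x^-1)%R) 0.
have := pavM_gt0 (v := w) (x := x) (y := (x^-1)%R).
rewrite wx divff// pav1 lt0y lt_def wy pav_ge0 => /(_ isT isT).
by rewrite gt0_mulye ?lt_def ?wy ?pav_ge0.
Qed.

Lemma pav_inv0 x : x != 0%R -> w x = 0 -> w (x^-1)%R = +oo.
Proof.
move=> x0 wx; apply/eqP; apply: contraT; rewrite -ltey => wy.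
have : w (x * x^-1)%R = w x * w (x^-1)%R by apply: pavM_fin; rewrite ?wx.
by rewrite divff// pav1 wx mul0e => /eqP; rewrite onee_eq0.
Qed.

Lemma pav_finM x y : w x < +oo -> w y < +oo -> w (x * y)%R < +oo.
Proof. by move=> hx hy; have [_ _] := fin_closed w; apply. Qed.

Lemma pavM0 x y : w x < +oo -> w y = 0 -> w (x * y)%R = 0.
Proof. by move=> hx hy; rewrite pavM_fin ?hy// mule0. Qed.

Lemma pavD0 x y : w x = 0 -> w y = 0 -> w (x + y)%R = 0.
Proof.
move=> hx hy; apply/eqP; rewrite eq_le pav_ge0 andbT.
by apply: le_trans (pavD _ _ _) _; rewrite hx hy adde0.
Qed.

Lemma pav_sum0 I (r : seq I) (G : I -> F) :
  (forall i, w (G i) = 0) -> w (\sum_(i <- r) G i)%R = 0.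
Proof.
by move=> hG; elim/big_rec: _ => [|i x _ hx]; [exact: pav0 | exact: pavD0].
Qed.

Lemma pav_finX x n : w x < +oo -> w (x ^+ n)%R < +oo.
Proof.
move=> hx; elim: n => [|n IH]; first by rewrite expr0 pav1 ltry.
by rewrite exprS pav_finM.
Qed.

Lemma pav_ext (w' : pseudo_absval R F) : (forall x, w x = w' x) -> w = w'.
Proof.
move=> e; have {}e : pav_fun w = pav_fun w' by exact: funext.
case: w w' e => [f f1 f2 f3 f4 f5] [g g1 g2 g3 g4 g5] /= e.
move: f1 f2 f3 f4 f5; rewrite e => f1 f2 f3 f4 f5.
congr PseudoAbsval; exact: Prop_irrelevance.
Qed.

(** The finiteness ring is a valuation ring, so some entry of a nonzero family
    divides all the others. *)
Lemma pav_normalize (s : seq F) : (exists2 x, x \in s & x != 0%R) ->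
  exists y, [/\ y \in s, y != 0%R & forall x, x \in s -> w (x / y)%R < +oo].
Proof.
elim: s => [[]//|x s IH] xs0.
have [/IH[y [ys y0 hy]]|ns] := pselect (exists2 y, y \in s & y != 0%R); last first.
  have s0 z : z \in s -> z = 0%R.
    by move=> zs; apply: contrapT => /eqP z0; apply: ns; exists z.
  have x0 : x != 0%R.
    by case: xs0 => z; rewrite inE => /orP[/eqP -> //|/s0 ->]; rewrite eqxx.
  exists x; split; rewrite ?mem_head// => z; rewrite inE => /orP[/eqP ->|/s0 ->].
    by rewrite divff// pav1 ltry.
  by rewrite mul0r pav0 ltry.
have [xy|xy] := boolP (w (x / y)%R < +oo).
  exists y; split; rewrite ?inE ?ys ?orbT// => z; rewrite inE => /orP[/eqP -> //|].
  exact: hy.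
have yx0 : w (y / x)%R = 0.
  by rewrite -[(y / x)%R]invrK invf_div; apply: pav_inv_infty; apply/eqP; rewrite -leye_eq leNgt.
have x0 : x != 0%R by apply: contraNneq xy => ->; rewrite mul0r pav0 ltry.
exists x; split; rewrite ?mem_head// => z; rewrite inE => /orP[/eqP ->|zs].
  by rewrite divff// pav1 ltry.
have -> : (z / x = z / y * (y / x))%R by rewrite mulrA divfK.
by apply: pav_finM; [exact: hy | rewrite yx0].
Qed.

Lemma fin_elt x : w x < +oo -> exists y : fin_ring w, sr_val y = x.
Proof. by move=> wx; exists (SubringElt (A := fin_ring w) wx). Qed.

Lemma pav_normalize_family n (c : 'I_n -> F) : (exists i, c i != 0%R) ->
  exists k (d : 'I_n -> fin_ring w),
    [/\ c k != 0%R, d k = 1%R & forall i, (sr_val (d i) = c i / c k)%R].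
Proof.
move=> [i ci].
have [|y [/mapP[k _ ->] ck hk]] := @pav_normalize (map c (enum 'I_n)).
  by exists (c i) => //; apply: map_f; rewrite mem_enum.
have hd l : w (c l / c k)%R < +oo by apply: hk; apply: map_f; rewrite mem_enum.
pose d l := projT1 (cid (fin_elt (hd l))).
have dE l : (sr_val (d l) = c l / c k)%R by exact: (projT2 (cid (fin_elt (hd l)))).
by exists k, d; split=> //; apply: sr_val_inj; rewrite dE sr_val1 divff.
Qed.

End PavTheory.

(** * Localisations of the integral closure *)

Section MaxIdealTheory.
Variables (B : comNzRingType) (m : max_ideal B).

Lemma mi_memD x y : m x -> m y -> m (x + y).
Proof. by move=> mx my; have [_ _ h] := mi_ideal m; have := h 1 x y mx my; rewrite mul1r. Qed.

Lemma mi_memM x y : m y -> m (x * y).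
Proof. by move=> my; have [h0 _ h] := mi_ideal m; have := h x y 0 my h0; rewrite addr0. Qed.

End MaxIdealTheory.

Section IntegralClosureTheory.
Variables (R : realType) (K : fieldType) (K' : fieldExtType K).
Variable v : pseudo_absval R K.
Local Notation A := (fin_ring v).
Local Notation A' := (int_closure K' v).
Local Notation inj := (fin_inj K' v).
Local Notation integral := (integralOver inj).

Lemma int_elt x : integral x -> exists y : A', sr_val y = x.
Proof. by move=> /asboolP ix; exists (SubringElt (A := A') ix). Qed.

Lemma int_valP (x : A') : integral (sr_val x).
Proof. exact/asboolP/(sr_valP x). Qed.

(** Divide a relation by a coefficient of largest value. *)
Lemma normalized_relation n (y : 'I_n -> K') : ~ lin_indep (in_alg K') y ->
  exists k (d : 'I_n -> A), d k = 1 /\ \sum_l inj (d l) * y l = 0.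
Proof.
move=> /existsNP[c /not_implyP[c0 /existsNP[i /eqP ci]]].
have [|k [d [ck dk hd]]] := @pav_normalize_family _ _ v _ c; first by exists i.
exists k, d; split=> //.
have e0 : ((c k)^-1)%:A * lincomb (in_alg K') y c = 0 by rewrite c0 mulr0.
rewrite -[RHS]e0 mulr_sumr; apply: eq_bigr => l _.
rewrite mulrA; congr (_ * _); rewrite -[LHS]/((sr_val (d l))%:A) hd.
by rewrite -[RHS](rmorphM (in_alg K')) mulrC.
Qed.

Lemma normalized_root (x : K') : exists (p : {poly A}) k,
  p`_k = 1 /\ (map_poly inj p).[x] = 0.
Proof.
have [q [qm _ Dq]] := minPoly_descent x.
have sq : (0 < size q)%N by rewrite size_poly_gt0 monic_neq0.
have [|k [d [dk rel]]] := @normalized_relation (size q) (fun i => x ^+ i).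
  move=> /(_ (fun i => q`_i)) ind.
  have hl : ((size q).-1 < size q)%N by rewrite prednK.
  have : q`_(Ordinal hl) = 0.
    apply: ind; rewrite /lincomb -[RHS](minPolyxx 1%AS x) Dq.
    rewrite (@horner_coef_wide _ (size q)) ?size_map_poly//.
    by apply: eq_bigr => i _; rewrite coef_map.
  by rewrite /= -lead_coefE (monicP qm) => /eqP; rewrite oner_eq0.
pose p : {poly A} := \poly_(i < size q) (if insub i is Some j then d j else 0).
have pE (i : 'I_(size q)) : p`_i = d i by rewrite coef_poly ltn_ord valK.
exists p, k; split; first by rewrite pE.
rewrite (@horner_coef_wide _ (size q)); last first.
  by rewrite (leq_trans (size_poly _ _))// size_poly.
by rewrite -[RHS]rel; apply: eq_bigr => i _; rewrite coef_map pE.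
Qed.

(** Multiplying the relation by [b^(j-1)] turns it into a monic equation for
    [b x] with integral coefficients. *)
Lemma integral_mul_root (b x : K') (r : {poly A}) j : (0 < j)%N -> integral b ->
  (size r <= j)%N -> b * x ^+ j + (map_poly inj r).[x] = 0 -> integral (b * x).
Proof.
case: j => // j _ ib rj e.
pose s : {poly K'} := \poly_(i < j.+1) (inj r`_i * b ^+ (j - i)).
have sj : (size s < size ('X^(j.+1) : {poly K'}))%N.
  by rewrite size_polyXn ltnS size_poly.
apply: (@integral_root_monic _ _ inj (b * x) ('X^(j.+1) + s)).
- by rewrite monicE lead_coefDl// lead_coefXn.
- rewrite /root hornerD hornerXn (@horner_coef_wide _ j.+1) ?size_poly//.
  have -> : \sum_(i < j.+1) s`_i * (b * x) ^+ i = b ^+ j * (map_poly inj r).[x].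
    rewrite (@horner_coef_wide _ j.+1); last by rewrite (leq_trans (size_poly _ _)).
    rewrite mulr_sumr; apply: eq_bigr => i _; rewrite coef_poly ltn_ord coef_map /=.
    have -> : b ^+ j = b ^+ (j - i) * b ^+ i by rewrite -exprD subnK// -ltnS.
    by rewrite exprMn; ring.
  have -> : (b * x) ^+ j.+1 = b ^+ j * (b * x ^+ j.+1) by rewrite exprMn exprSr mulrA.
  by rewrite -mulrDr e mulr0.
apply/integral_poly => i; rewrite coefD coefXn coef_poly.
apply: integral_add; first exact: integral_nat.
case: ifP => _; last exact: integral0.
apply: integral_mul; first exact: integral_id.
by elim: (j - i)%N => [|l IH]; [exact: integral1 | rewrite exprS; exact: integral_mul].
Qed.

(** Write [b_j] for the value at [x] of [p] without its terms of degree less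
    than [j], divided by the [j]-th power of the variable.  As
    [b_j = b_(j+1) x + p_j], integrality descends from large [j], where
    [b_j = 0]. *)
Lemma integral_truncation (p : {poly A}) (x : K') j : (map_poly inj p).[x] = 0 ->
  let b := (map_poly inj (drop_poly j p)).[x] in integral b /\ integral (b * x).
Proof.
move=> p0.
have [d] : exists d, (size p <= j + d)%N by exists (size p); exact: leq_addl.
elim: d j => [|d IH] j hj /=.
  rewrite addn0 in hj; rewrite drop_poly_eq0// rmorph0 horner0 mul0r.
  by split; exact: integral0.
have [ib ibx] := IH j.+1 ltac:(by rewrite addSnnS).
have Dj : drop_poly j p = drop_poly j.+1 p * 'X + (p`_j)%:P.
  apply/polyP => i; rewrite coefD coefMX coefC !coef_drop_poly.
  by case: i => [|i]; rewrite /= ?add0r// addr0 addSnnS.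
have ibj : integral (map_poly inj (drop_poly j p)).[x].
  rewrite Dj rmorphD rmorphM /= map_polyX map_polyC hornerD hornerMX hornerC.
  by apply: integral_add => //; exact: integral_id.
split=> //; case: j => [|j] in hj ib ibx Dj ibj *.
  by rewrite drop_poly0l p0 mul0r; exact: integral0.
apply: (@integral_mul_root _ _ (take_poly j.+1 p) j.+1) => //; first exact: size_take_poly.
rewrite -hornerXn -hornerM -hornerD -(map_polyXn inj) -rmorphM -rmorphD.
by rewrite addrC poly_take_drop.
Qed.

(** Consecutive truncations around a coefficient [1]: the case [p_k = 1] of
    [b_k = b_(k+1) x + p_k]. *)
Lemma integral_splitting (x : K') : exists b c : K',
  [/\ integral b, integral c, integral (b * x), integral (c * x) & b = c * x + 1].
Proof.
have [p [k [pk p0]]] := normalized_root x.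
have [ib ibx] := integral_truncation k p0; have [ic icx] := integral_truncation k.+1 p0.
eexists _, _; split; [exact: ib | exact: ic | exact: ibx | exact: icx |].
have -> : drop_poly k p = drop_poly k.+1 p * 'X + (p`_k)%:P.
  apply/polyP => i; rewrite coefD coefMX coefC !coef_drop_poly.
  by case: i => [|i]; rewrite /= ?add0r// addr0 addSnnS.
rewrite pk rmorphD rmorphM /= map_polyX map_polyC hornerD hornerMX hornerC /=.
by rewrite scale1r.
Qed.

Section AtMaximalIdeal.
Variable m : max_ideal A'.

Lemma loc_elt x : localization m x -> exists y : localization m, sr_val y = x.
Proof. by move=> lx; exists (SubringElt (A := localization m) lx). Qed.

Lemma int_loc (x : A') : localization m (sr_val x).
Proof. by apply/asboolP; exists x, 1; split; [exact: den1 | rewrite sr_val1 divr1]. Qed.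

(** With [b = c x + 1] and [b], [c], [b x], [c x] integral: if [b] is outside
    [m] then [x = (b x) / b]; otherwise [c x] is outside [m], and either
    [x = (c x) / c] or [x^-1 = c / (c x)] with [c] in [m]. *)
Lemma localization_valuation (x : K') :
  localization m x \/ exists2 y : localization m, loc_max m y & sr_val y = x^-1.
Proof.
have [b [c [/int_elt[b' Db] /int_elt[c' Dc] /int_elt[bx Dbx] /int_elt[cx Dcx] e]]] := integral_splitting x.
have e' : b' = cx + 1 by apply: sr_val_inj; rewrite sr_valD sr_val1 Db Dcx.
have [mb|nb] := boolP (m b'); last first.
  left; apply/asboolP; exists bx, b'; split=> //; rewrite Dbx Db mulrAC divff ?mul1r//.
  by rewrite -Db (den_neq0 nb).
have ncx : ~~ m cx.
  apply/negP => mcx; have : m 1.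
    have -> : 1 = b' + (-1) * cx by rewrite e'; ring.
    by apply: mi_memD => //; exact: mi_memM.
  by apply/negP; exact: den1.
have cx0 := den_neq0 ncx.
have c0 : c != 0 by apply: contraNneq cx0 => c0; rewrite Dcx c0 mul0r.
have [mc|nc] := boolP (m c'); last first.
  by left; apply/asboolP; exists cx, c'; split=> //; rewrite Dcx Dc mulrAC divff ?mul1r.
right; have ex : x^-1 = sr_val c' / sr_val cx.
  by rewrite Dc Dcx invfM mulrA divff ?mul1r.
have lx : localization m x^-1 by apply/asboolP; exists c', cx.
exists (SubringElt (A := localization m) lx) => //.
by apply/asboolP; exists c', cx.
Qed.

Lemma loc_max_int (x : A') (y : localization m) : sr_val y = sr_val x -> loc_max m y = m x.
Proof. by move=> e; apply: (loc_maxE (den1 m)); rewrite e sr_val1 divr1. Qed.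

Lemma loc_max_unit (x y : localization m) : sr_val x * sr_val y = 1 -> ~~ loc_max m x.
Proof.
move=> e; apply/negP => mx; have [h0 h1 h] := mi_ideal (loc_max m).
case/negP: h1; have -> : 1 = y * x + 0.
  by apply: sr_val_inj; rewrite addr0 sr_valM mulrC e sr_val1.
exact: h.
Qed.

(** A normalized relation between lifts stays nontrivial modulo the maximal
    ideal, so independent residues have independent lifts. *)
Lemma kappa_indep_lift n (u : 'I_n -> kappa m) : lin_indep (kappa_map m) u ->
  lin_indep (in_alg K') (fun i => sr_val (resid_repr (u i))).
Proof.
move=> iu; apply: contrapT => /normalized_relation[k [d [dk rel]]].
have {}rel : \sum_l fin_to_loc m (d l) * resid_repr (u l) = 0.
  apply: sr_val_inj; rewrite sr_val0 rmorph_sum -[RHS]rel.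
  by apply: eq_bigr => l _; exact: sr_valM.
have : lincomb (kappa_map m) u (fun l => resid (fin_max v) (d l)) = 0.
  have := congr1 (resid (loc_max m)) rel; rewrite rmorph0 rmorph_sum => rel0.
  rewrite -[RHS]rel0; apply: eq_bigr => l _.
  apply/esym; apply: etrans (rmorphM (resid (loc_max m)) _ _) _.
  congr (_ * _); last exact: resid_reprK.
  by apply/esym; exact: residue_mapE.
by move=> /iu/(_ k)/eqP; rewrite dk rmorph1 oner_eq0.
Qed.

Lemma kappa_finite : finite_ext (kappa_map m).
Proof.
by apply: (@bounded_indep_finite _ _ _ (\dim {:K'})) => n e /kappa_indep_lift/fieldExt_indep_le.
Qed.
End AtMaximalIdeal.
End IntegralClosureTheory.

(** * Maximal ideals of the integral closure and their residual absolute values *)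

Section MaximalIdeals.
Variables (R : realType) (K : fieldType) (K' : fieldExtType K).
Variable v : pseudo_absval R K.
Local Notation A' := (int_closure K' v).

Lemma max_ideal_eq (B : comNzRingType) (I J : max_ideal B) : (forall x, I x = J x) -> I = J.
Proof.
move=> e; have {}e : mi_pred I = mi_pred J by exact: funext.
case: I J e => [p p1 p2] [q q1 q2] /= e; move: p1 p2; rewrite e => p1 p2.
congr MaxIdeal; exact: Prop_irrelevance.
Qed.

Lemma max_ideal_separate (B : comNzRingType) (I J : max_ideal B) : I <> J ->
  exists x, J x /\ ~~ I x.
Proof.
move=> IJ; apply: contrapT => /forallNP h; apply: IJ.
have JI : {subset mi_pred J <= mi_pred I}.
  by move=> x Jx; apply: contraT => Ix; case: (h x).
apply: max_ideal_eq => x; apply/idP/idP; last exact: JI.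
by move=> Ix; exact: (mi_max (mi_ideal I) JI).
Qed.

(** For each ideal, a product of separating elements lies outside it and inside
    all the others.  These products are independent over [K]: a normalized
    relation would put the one with coefficient [1] into its own ideal. *)
Lemma spm_bound (s : seq (Spm K' v)) : uniq s -> (size s <= \dim {:K'})%N.
Proof.
move=> us; set n := size s; pose t := tnth (in_tuple s).
have tinj (i l : 'I_n) : i != l -> t i <> t l.
  by move=> il /eqP; rewrite /t !(tnth_nth (t i)) nth_uniq//= => /eqP/ord_inj e; rewrite e eqxx in il.
have sep (i l : 'I_n) : exists x : A', i != l -> t l x /\ ~~ t i x.
  have [->|il] := eqVneq i l; first by exists 0.
  by have [x hx] := max_ideal_separate (tinj i l il); exists x.
pose x i l := projT1 (cid (sep i l)).
have xP i l : i != l -> t l (x i l) /\ ~~ t i (x i l) by exact: (projT2 (cid (sep i l))).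
pose e i := \prod_(l | i != l) x i l.
have ei i : ~~ t i (e i).
  apply: (big_ind (fun y => ~~ t i y)); [exact: den1 | exact: max_primeN |].
  by move=> l /xP[].
have el i l : i != l -> t l (e i).
  by move=> il; rewrite /e (bigD1 l)//= mulrC; apply: mi_memM; case: (xP i l il).
apply: (@fieldExt_indep_le _ _ _ (fun i => sr_val (e i))).
apply: contrapT => /(normalized_relation v)[k [d [dk rel]]].
have {}rel : \sum_l fin_to_int K' (d l) * e l = 0.
  apply: sr_val_inj; rewrite sr_val0 rmorph_sum -[RHS]rel.
  by apply: eq_bigr => l _; exact: sr_valM.
move: rel; rewrite (bigD1 k)//= dk rmorph1 mul1r => /eqP; rewrite addr_eq0 => /eqP ek.
have := ei k; rewrite ek -mulN1r => /negP; apply; apply: mi_memM.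
apply: (big_ind (fun y => t k y)); [by case: (mi_ideal (t k)) | exact: mi_memD |].
by move=> l lk; apply: mi_memM; exact: el.
Qed.

Lemma spm_finite : finite_set [set: Spm K' v]%classic.
Proof.
apply: contrapT => /infinite_set_fsetP/(_ (\dim {:K'}).+1)[B _].
by rewrite leqNgt ltnS (spm_bound (fset_uniq B)).
Qed.

(** Zorn's lemma; adding [0] by hand turns the union of the empty chain into an
    ideal. *)
Lemma max_ideal_exists (B : comNzRingType) : inhabited (max_ideal B).
Proof.
pose P (X : set B) := idealr_closed (fun x : B => `[< X x \/ x = 0 >]).
have [|I [PI Imax]] := @Zorn_bigcup B P.
  move=> F FP tot; split.
  - by apply/asboolP; right.
  - apply/negP => /asboolP[[X FX X1]|/eqP]; last by rewrite oner_eq0.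
    by have [_ /negP h _] := FP X FX; apply: h; apply/asboolP; left.
  - move=> c x y /asboolP hx /asboolP hy; apply/asboolP.
    have mem X z : F X -> `[< X z \/ z = 0 >] -> (\bigcup_(X in F) X)%classic z \/ z = 0.
      by move=> FX /asboolP[Xz|->]; [left; exists X | right].
    have [[X FX Xx]|x0] := hx; have [[Y FY Yy]|y0] := hy.
    - have [XY|YX] := tot X Y FX FY.
        apply: (mem Y) => //; have [_ _ h] := FP Y FY; apply: h; apply/asboolP; left=> //; exact: XY.
      apply: (mem X) => //; have [_ _ h] := FP X FX; apply: h; apply/asboolP; left=> //; exact: YX.
    - apply: (mem X) => //; have [_ _ h] := FP X FX; apply: h; apply/asboolP; [left|right]; by [].
    - apply: (mem Y) => //; have [_ _ h] := FP Y FY; apply: h; apply/asboolP; [right|left]; by [].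
    - by right; rewrite x0 y0 mulr0 addr0.
constructor; apply: (MaxIdeal PI) => J hJ IJ x Jx.
pose X : set B := [set z | z \in J]%classic.
have [J0 J1 JD] := hJ.
have XE : (fun x : B => `[< X x \/ x = 0 >]) = (J : B -> bool).
  apply: funext => z; apply/asboolP/idP; first by case=> [//|->].
  by left.
apply: contraT => nIx; exfalso; apply: (Imax X); last by rewrite /P XE.
split; last by move=> XI; case/negP: nIx; apply/asboolP; left; exact: XI.
by move=> z Iz; apply: IJ; apply/asboolP; left.
Qed.

End MaximalIdeals.

Section Above.
Variables (R : realType) (K : fieldType) (K' : fieldExtType K).
Variable v : pseudo_absval R K.
Local Notation A := (fin_ring v).
Local Notation A' := (int_closure K' v).
Local Notation inj := (fin_inj K' v).
Local Open Scope ereal_scope.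

Section Contraction.
Variable w : pav_above K' v.

Lemma above_inj (a : A) : w (inj a) = v (sr_val a).
Proof. exact: above_pavE. Qed.

Lemma above_inj_fin (a : A) : w (inj a) < +oo.
Proof. by rewrite above_inj fin_valP. Qed.

(** If [w x] were infinite then [w x^-1 = 0], and dividing a monic equation of
    [x] by the leading power would give [w 1 = 0]. *)
Lemma integral_fin x : integralOver inj x -> w x < +oo.
Proof.
move=> [p pm px]; rewrite ltey; apply/eqP => wx.
have x0 : x != 0%R by apply/eqP => x0; move: wx; rewrite x0 pav0.
have wy := pav_inv_infty wx; set y := (x^-1)%R in wy.
set n := (size p).-1; have szp : size p = n.+1.
  by rewrite prednK// size_poly_gt0 monic_neq0.
have : w (y ^+ n * (map_poly inj p).[x])%R = 0 by rewrite (rootP px) mulr0 pav0.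
rewrite (@horner_coef_wide _ n.+1); last by rewrite -szp size_poly.
have pn : ((map_poly inj p)`_n = 1)%R.
  have lc : p`_n = 1%R by have := monicP pm; rewrite lead_coefE.
  by rewrite coef_map lc; exact: rmorph1.
have -> : (\sum_(i < n.+1) (map_poly inj p)`_i * x ^+ i =
    \sum_(i < n) (map_poly inj p)`_i * x ^+ i + x ^+ n)%R.
  by rewrite big_ord_recr; congr (_ + _)%R; rewrite -[RHS]mul1r -pn.
rewrite mulrDr -exprMn mulVf// expr1n => w1.
have ws : w (y ^+ n * \sum_(i < n) (map_poly inj p)`_i * x ^+ i)%R = 0.
  rewrite mulr_sumr; apply: pav_sum0 => i.
  have -> : (y ^+ n * ((map_poly inj p)`_i * x ^+ i) = inj p`_i * (y ^+ (n - i)))%R.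
    have -> : (y ^+ n = y ^+ (n - i) * y ^+ i)%R by rewrite -exprD subnK// ltnW.
    rewrite coef_map -mulrA [(y ^+ i * _)%R]mulrCA -exprMn mulVf// expr1n mulr1.
    by rewrite mulrC.
  apply: pavM0; first exact: above_inj_fin.
  have : (0 < n - i)%N by rewrite subn_gt0.
  case: (n - i)%N => // l _; rewrite exprSr; apply: pavM0 => //.
  by apply: pav_finX; rewrite wy.
have := pavD0 w1 (etrans (pavN w _) ws).
by rewrite addrC addKr pav1 => /eqP; rewrite onee_eq0.
Qed.

Lemma int_fin (x : A') : w (sr_val x) < +oo.
Proof. exact: integral_fin (int_valP x). Qed.

(** Modulo the maximal ideal of [w], an equation of [x] stays valid after
    division by [x] as long as its constant term vanishes there; once that term
    is a unit, the equation expresses an inverse of [x]. *)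
Lemma residue_inverse (p : {poly A}) (x : A') : w (sr_val x) != 0 ->
  (exists i, v (sr_val p`_i) != 0) ->
  w (sr_val (map_poly (fin_to_int K' (v := v)) p).[x]%R) = 0 ->
  exists y : A', w (sr_val (x * y - 1)%R) = 0.
Proof.
move=> wx; have wx' : 0 < w (sr_val x) < +oo by rewrite lt_def wx pav_ge0 int_fin.
elim/poly_ind: p => [[i]|p c IH [i hi]]; first by rewrite coef0 pav0 eqxx.
rewrite rmorphD rmorphM /= map_polyX map_polyC hornerD hornerMX hornerC /=.
set q := (map_poly _ p).[x]%R => e.
have [vc|vc] := eqVneq (v (sr_val c)) 0; last first.
  have [d cd] := fin_unit vc; exists (- (q * fin_to_int K' d))%R.
  have E : (x * (- (q * fin_to_int K' d)) - 1 =
      fin_to_int K' (- d) * (q * x + fin_to_int K' c))%R.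
    have -> : (1 = fin_to_int K' c * fin_to_int K' d :> A')%R by rewrite -rmorphM cd rmorph1.
    by rewrite rmorphN; ring.
  apply: etrans (congr1 (fun z => w (sr_val z)) E) _.
  by rewrite sr_valM; apply: pavM0 => //; exact: int_fin.
apply: IH.
  case: i hi => [|i]; rewrite coefD coefMX coefC /=; first by rewrite add0r vc eqxx.
  by rewrite addr0; exists i.
have wc : w (sr_val (fin_to_int K' c)) = 0 by rewrite -vc -above_inj.
have : w (sr_val (q * x)%R) = 0.
  have -> : (q * x = (q * x + fin_to_int K' c) - fin_to_int K' c)%R by rewrite addrK.
  by rewrite sr_valB; apply: pavD0 => //; rewrite pavN.
rewrite mulrC sr_valM pavM_unit// => /eqP; rewrite mule_eq0 (negbTE wx) /= => /eqP.
by [].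
Qed.

Lemma contraction_ideal : idealr_closed (fun x : A' => w (sr_val x) == 0).
Proof.
split; rewrite ?unfold_in /=; first by rewrite pav0.
  by rewrite pav1 onee_eq0.
move=> u x y; rewrite !unfold_in => /eqP x0 /eqP y0; rewrite sr_valD sr_valM.
by apply/eqP; apply: pavD0 => //; apply: pavM0 => //; exact: int_fin.
Qed.

Lemma contraction_inv (x : A') : w (sr_val x) != 0 ->
  exists y, w (sr_val (x * y - 1)%R) == 0.
Proof.
move=> wx; have [p pm px] := int_valP x.
have [||y /eqP wy] := @residue_inverse p x wx; last by exists y.
  exists (size p).-1; rewrite -lead_coefE (monicP pm) sr_val1 pav1.
  exact: onee_neq0.
have -> : ((map_poly (fin_to_int K' (v := v)) p).[x] = 0)%R; last by rewrite sr_val0 pav0.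
by apply: sr_val_inj; rewrite sr_val0 -horner_map -map_poly_comp; exact/rootP.
Qed.

Definition contraction : Spm K' v := MaxIdeal contraction_ideal (max_of_inv contraction_inv).

Lemma den_val (s : A') : ~~ contraction s -> 0 < w (sr_val s) < +oo.
Proof. by move=> ws; rewrite lt_def ws pav_ge0 int_fin. Qed.

Lemma pav_quot (x y : K') : 0 < w y < +oo -> w (x / y)%R < +oo = (w x < +oo) /\ (w (x / y)%R == 0) = (w x == 0).
Proof.
move=> wy; have y0 : y != 0%R by apply/eqP => y0; move: wy; rewrite y0 pav0 ltxx.
have e : w x = w y * w (x / y)%R by rewrite -(pavM_unit (x / y)%R wy) mulrC divfK.
have [wy0 wyoo] := andP wy.
split; first last.
  by rewrite [in RHS]e mule_eq0 [w y == 0](gt_eqF wy0).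
rewrite [in RHS]e; case: (w (x / y)%R) (pav_ge0 w (x / y)%R) => [r| |] //= r0.
  by rewrite ltry; apply/esym; apply: lte_mul_pinfty; rewrite ?ltry ?ge0_fin_numE ?ltW.
by rewrite gt0_muley// ltxx.
Qed.

Lemma loc_fin (x : localization contraction) : w (sr_val x) < +oo.
Proof.
have /asboolP[a [s [ms ->]]] := sr_valP x.
by rewrite (pav_quot _ (den_val ms)).1 int_fin.
Qed.

Lemma loc_max_val (x : localization contraction) : loc_max contraction x = (w (sr_val x) == 0).
Proof.
have /asboolP[a [s [ms ex]]] := sr_valP x.
by rewrite -[LHS]/(loc_max_pred x) (loc_maxE ms ex) ex (pav_quot _ (den_val ms)).2.
Qed.

Definition loc_to_fin (x : localization contraction) : fin_ring w :=
  SubringElt (A := fin_ring w) (loc_fin x).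

Lemma loc_to_fin_zmod : zmod_morphism loc_to_fin.
Proof. by move=> x y; apply: sr_val_inj; rewrite !sr_valB. Qed.
Lemma loc_to_fin_monoid : monoid_morphism loc_to_fin.
Proof.
split; first by apply: sr_val_inj; rewrite sr_val1.
by move=> x y; apply: sr_val_inj; rewrite !sr_valM.
Qed.
HB.instance Definition _ := GRing.isZmodMorphism.Build
  (localization contraction) (fin_ring w) loc_to_fin loc_to_fin_zmod.
HB.instance Definition _ := GRing.isMonoidMorphism.Build
  (localization contraction) (fin_ring w) loc_to_fin loc_to_fin_monoid.

Lemma loc_to_fin_max x : loc_max contraction x -> fin_max w (loc_to_fin x).
Proof. by rewrite loc_max_val. Qed.

Definition contraction_av : absval R (kappa contraction) :=
  av_restrict (residue_map loc_to_fin_max : {rmorphism _ -> _}) (res_absval w).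

Lemma contraction_avE (x : localization contraction) :
  w (sr_val x) = (contraction_av (resid (loc_max contraction) x))%:E.
Proof.
rewrite /contraction_av /= residue_mapE res_avE fineK//.
exact: (fin_val_num (loc_to_fin x)).
Qed.

Lemma contraction_av_ext c : contraction_av (kappa_map contraction c) = res_absval v c.
Proof.
rewrite -[c]resid_reprK; set x := resid_repr c.
have -> : kappa_map contraction (resid (fin_max v) x) =
  resid (loc_max contraction) (fin_to_loc contraction x) by exact: residue_mapE.
apply: EFin_inj; rewrite -contraction_avE /= res_avE fineK ?fin_val_num//.
exact: above_inj.
Qed.

Definition contraction_ext : residue_ext contraction := AbsvalExt contraction_av_ext.
End Contraction.
End Above.

(** * Pseudo-absolute values above a given one *)

Section Correspondence.
Variables (R : realType) (K : fieldType) (K' : fieldExtType K).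
Variable v : pseudo_absval R K.
Local Notation A := (fin_ring v).
Local Notation data := {m : Spm K' v & residue_ext m}.
Local Open Scope ereal_scope.

Definition corresponds (w : pav_above K' v) (s : data) :=
  (forall x : int_closure K' v, projT1 s x <-> w (sr_val x) = 0%E) /\
  (forall x : localization (projT1 s),
      w (sr_val x) = (projT2 s (resid (loc_max (projT1 s)) x))%:E).

Lemma corresponds_contraction w : corresponds w (existT _ (contraction w) (contraction_ext w)).
Proof.
split=> x /=; last exact: contraction_avE.
by split=> /eqP.
Qed.

Section Converse.
Variables (m : Spm K' v) (i : residue_ext m).
Local Notation O := (localization m).
Local Notation rs := (resid (loc_max m)).

Lemma not_loc_inv x : ~ localization m x ->
  x != 0%R /\ exists2 y : O, loc_max m y & sr_val y = (x^-1)%R.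
Proof.
move=> nx; have [//|h] := localization_valuation m x; split=> //.
apply/eqP => x0; apply: nx; rewrite x0; have := sr_valP (0%R : O); by rewrite sr_val0.
Qed.

Lemma loc_max_not_loc (x : K') (y : O) : x != 0%R -> loc_max m y -> sr_val y = (x^-1)%R ->
  ~ localization m x.
Proof.
move=> x0 my ey /loc_elt[z ez]; have := @loc_max_unit _ _ _ _ m y z.
by rewrite ey ez mulVf// my => /(_ erefl).
Qed.

Definition glue (x : K') : \bar R :=
  match pselect (localization m x) with
  | left lx => (i (rs (SubringElt (A := O) lx)))%:E
  | right _ => +oo
  end.

Lemma glueE (x : O) : glue (sr_val x) = (i (rs x))%:E.
Proof.
rewrite /glue; case: pselect => [lx|[]]; last exact: sr_valP.
by congr (i (rs _))%:E; apply: sr_val_inj.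
Qed.

Lemma glue_infty x : ~ localization m x -> glue x = +oo.
Proof. by rewrite /glue; case: pselect. Qed.

Lemma glue_ge0 x : 0 <= glue x.
Proof. by rewrite /glue; case: pselect => // lx; rewrite lee_fin av_ge0. Qed.

Lemma glue1 : glue 1%R = 1.
Proof. by have := glueE 1%R; rewrite sr_val1 rmorph1 av1. Qed.

Lemma glue0 : glue 0%R = 0.
Proof. by have := glueE 0%R; rewrite sr_val0 rmorph0 av0. Qed.

Lemma glueD x y : glue (x + y)%R <= glue x + glue y.
Proof.
have [/loc_elt[a <-]|nx] := pselect (localization m x); last first.
  by rewrite (glue_infty nx) addye ?leey// gt_eqF// (lt_le_trans _ (glue_ge0 y)).
have [/loc_elt[b <-]|ny] := pselect (localization m y); last first.
  by rewrite (glue_infty ny) addey ?leey// gt_eqF// (lt_le_trans _ (glue_ge0 _)).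
by rewrite -sr_valD !glueE -EFinD lee_fin rmorphD avD.
Qed.

Lemma loc_unit (x : O) : rs x != 0%R -> localization m ((sr_val x)^-1)%R.
Proof.
move=> nx; apply: contrapT => /not_loc_inv[_ [y my]]; rewrite invrK => /sr_val_inj e.
by move: nx; rewrite resid_eq0 -e my.
Qed.

(** An element of nonzero residue is a unit of the localisation, so it cannot
    bring [y] into it. *)
Lemma glueM_infty (x : O) y : rs x != 0%R -> ~ localization m y ->
  glue (sr_val x * y)%R = glue (sr_val x) * glue y.
Proof.
move=> nx ny; rewrite (glue_infty ny) glueE gt0_muley ?lte_fin ?av_gt0//.
apply: glue_infty => /loc_elt[z ez]; apply: ny.
have [u eu] := loc_elt (loc_unit nx).
have -> : y = sr_val (u * z)%R.
  rewrite sr_valM eu ez mulrA mulVf ?mul1r//.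
  apply: contraNneq nx => x0; have -> : x = 0%R by apply: sr_val_inj; rewrite x0 sr_val0.
  by rewrite rmorph0.
exact: sr_valP.
Qed.

Lemma glueM x y :
  [set glue x; glue y]%classic <> [set 0; +oo]%classic ->
  glue (x * y)%R = glue x * glue y.
Proof.
have [/loc_elt[a <-]|nx] := pselect (localization m x);
  have [/loc_elt[b <-]|ny] := pselect (localization m y) => h.
- by rewrite -sr_valM !glueE rmorphM avM.
- apply: glueM_infty => //; apply/eqP => a0; apply: h.
  by rewrite glueE a0 av0 (glue_infty ny).
- rewrite mulrC muleC; apply: glueM_infty => //; apply/eqP => b0; apply: h.
  by rewrite (glue_infty nx) glueE b0 av0 setUC.
- rewrite (glue_infty nx) (glue_infty ny) mulyy; apply: glue_infty.
  have [x0 [a ma ea]] := not_loc_inv nx; have [y0 [b mb eb]] := not_loc_inv ny.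
  apply: (@loc_max_not_loc _ (a * b)%R); rewrite ?mulf_neq0//.
    exact: mi_memM.
  by rewrite sr_valM ea eb invfM.
Qed.

Definition glue_pav : pseudo_absval R K' := PseudoAbsval glue_ge0 glue1 glue0 glueD glueM.

Lemma glue_above (x : K) : glue_pav (x%:A)%R = v x.
Proof.
have [/fin_elt[y <-]|nx] := boolP (v x < +oo).
  rewrite -[LHS]/(glue (sr_val (fin_to_loc m y))) glueE.
  have -> : rs (fin_to_loc m y) = kappa_map m (resid (fin_max v) y) by apply/esym; exact: residue_mapE.
  by rewrite ext_avE /= res_avE fineK ?fin_val_num.
have vx : v x = +oo by apply/eqP; rewrite -leye_eq leNgt.
have x0 : x != 0%R by apply: contraNneq nx => ->; rewrite pav0 ltry.
have vy := pav_inv_infty vx; have [y ey] : exists y : A, sr_val y = (x^-1)%R.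
  by apply: fin_elt; rewrite vy.
rewrite vx; apply: glue_infty; apply: (@loc_max_not_loc _ (fin_to_loc m y)).
- by rewrite scaler_eq0 oner_eq0 orbF.
- by apply: fin_max_to_loc; rewrite /= ey vy.
- by rewrite -[LHS]/((sr_val y)%:A)%R ey -[LHS]/(in_alg K' x^-1)%R fmorphV.
Qed.

Definition glue_pav_above : pav_above K' v := PavAbove glue_above.

Lemma corresponds_glue : corresponds glue_pav_above (existT _ m i).
Proof.
split=> [x|x] /=; last exact: glueE.
have [y ey] := loc_elt (int_loc m x).
rewrite -[X in glue X]ey glueE -(loc_max_int ey) -resid_eq0.
split=> [/eqP ->|[]]; first by rewrite av0.
by move/av_eq0/eqP.
Qed.
End Converse.

Lemma corresponds_unique w s s' : corresponds w s -> corresponds w s' -> s = s'.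
Proof.
case: s s' => [m i] [m' i'] [/= h1 h2] [/= h1' h2'].
have em : m = m'.
  by apply: max_ideal_eq => x; apply/idP/idP; [move/h1/h1' | move/h1'/h1].
move: i' h1' h2'; rewrite -em => i' _ h2'; congr existT.
apply: absval_ext_eq => c; rewrite -[c]resid_reprK.
by apply: EFin_inj; rewrite -h2 -h2'.
Qed.

(** Outside the localisation both are infinite, as both vanish at the inverse. *)
Lemma corresponds_val w w' s : corresponds w s -> corresponds w' s -> forall x, w x = w' x.
Proof.
case: s => [m i] [/= _ h] [/= _ h'] x.
have [/loc_elt[y <-]|nx] := pselect (localization m x); first by rewrite h h'.
have [x0 [y my ey]] := not_loc_inv nx.
have inf (u : pav_above K' v) : u (sr_val y) = (i (resid (loc_max m) y))%:E -> u x = +oo.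
  move=> uy; rewrite -[x]invrK; apply: pav_inv0; first by rewrite invr_eq0.
  by rewrite -ey uy; move: my; rewrite -resid_eq0 => /eqP ->; rewrite av0.
by rewrite !inf.
Qed.

Lemma corresponds_inj w w' s : corresponds w s -> corresponds w' s -> w = w'.
Proof.
move=> h h'; have e : above_pav w = above_pav w'.
  by apply: pav_ext; exact: corresponds_val h h'.
case: w w' e {h h'} => [u hu] [u' hu'] /= e; move: hu; rewrite e => hu.
congr PavAbove; exact: Prop_irrelevance.
Qed.

End Correspondence.

Theorem proposition3p1p2 (R : realType) (K : fieldType) (K' : fieldExtType K)
    (v : pseudo_absval R K) (sepK' : separable 1%VS {:K'}) :
  (exists f : pav_above K' v -> {m : Spm K' v & residue_ext m},
     bijective f /\
     forall w : pav_above K' v,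
       (forall x : int_closure K' v, projT1 (f w) x <-> w (sr_val x) = 0%E) /\
       (forall x : localization (projT1 (f w)),
          w (sr_val x) = (projT2 (f w) (resid (loc_max (projT1 (f w))) x))%:E))
  /\
  \sum_(m \in [set: Spm K' v]%classic)
     (1 / (#|` fset_set [set: Spm K' v]%classic |)%:R *
      \sum_(i \in [set: residue_ext m]%classic)
         ((sepdeg (completion_map i))%:R / (sepdeg (kappa_map m))%:R : rat))
  = 1.
Proof.
split.
  pose f w : {m : Spm K' v & residue_ext m} := existT _ (contraction w) (contraction_ext w).
  pose g (s : {m : Spm K' v & residue_ext m}) := glue_pav_above (projT2 s).
  exists f; split; last by move=> w; exact: corresponds_contraction.
  exists g => [w|[m i]].
    exact: corresponds_inj (corresponds_glue _) (corresponds_contraction w).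
  exact: corresponds_unique (corresponds_contraction _) (corresponds_glue i).
under eq_fsbigr => m _.
  rewrite (sum_local_sepdeg (res_absval v) (kappa_finite m)) mulr1; over.
rewrite fsbig_finite; last exact: spm_finite.
rewrite big_const_seq count_predT iter_addr_0 -[_ *+ _]mulr_natr div1r mulVf//.
have [m] := max_ideal_exists (int_closure K' v).
rewrite pnatr_eq0 -lt0n cardfs_gt0; apply/fset0Pn; exists m.
by rewrite in_fset_set ?inE//; exact: spm_finite.
Qed.
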